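(* Let $\gamma\in(0,1)$ and let $\Gamma(\gamma)\subset[0,1]$ be the percolation limit set with parameter $\gamma$. Then, almost surely, provided $\Gamma(\gamma)\ne\emptyset$, $$\dim_{MA}\Gamma(\gamma)=\dim_H\Gamma(\gamma)=1-\gamma.$$
   Context: For $n\in\mathbb{N}$ let $\mathcal{I}_n=\{[p2^{-n},(p+1)2^{-n}]:0\le p<2^n\}$ be the dyadic intervals of order $n$ in $[0,1]$. Percolation limit set: put $p=2^{-\gamma}$. Keep each interval $I\in\mathcal{I}_1$ (independently) with probability $p$; let $\Delta_1\subset\mathcal{I}_1$ be the collection of kept intervals and $S_1=\bigcup\Delta_1$. If $\Delta_n\subset\mathcal{I}_n$ and $S_n$ are already defined, keep every interval $I\in\mathcal{I}_{n+1}$ for which $I\subset S_n$ independently with probability $p$; let $\Delta_{n+1}\subset\mathcal{I}_{n+1}$ be the collection of kept intervals and $S_{n+1}=\bigcup\Delta_{n+1}$. Then $\Gamma(\gamma)=\bigcap_{n=1}^\infty S_n$. $\dim_H$ is Hausdorff dimension. Modified Assouad dimension: let $X$ be a totally bounded metric space, let $B(x,r)$ denote the closed ball of radius $r$ around $x$, and for $A\subset X$ let $N_r(A)$ be the smallest number of closed balls of diameter $r$ required to cover $A$. For $0<\varepsilon<1$ put $$\dim_A^{\varepsilon}X=\inf\{\beta:\exists\, C<\infty \text{ such that for all } 0<r\le r^{1-\varepsilon}\le R \text{ we have } \sup\{N_r(B(x,R)):x\in X\}\le C(R/r)^{\beta}\},$$ $$\dim_{MA}^{\varepsilon}X=\inf\Big\{\sup_i\dim_A^{\varepsilon}X_i: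 X=\bigcup_{i=1}^\infty X_i\Big\},\qquad \dim_{MA}X=\sup_{0<\varepsilon<1}\dim_{MA}^{\varepsilon}X=\lim_{\varepsilon\to0+}\dim_{MA}^{\varepsilon}X.$$ *)

(* Defs.v *)
From HB Require Import structures.
From mathcomp Require Export all_boot all_order all_algebra.
From mathcomp Require Export finmap.
From mathcomp Require Export all_classical all_reals all_analysis.

Set Implicit Arguments.
Unset Strict Implicit.
Unset Printing Implicit Defensive.

Import Order.TTheory GRing.Theory Num.Theory.
Import numFieldNormedType.Exports.

Local Open Scope classical_set_scope.
Local Open Scope ring_scope.

Section dimensions.
Context {R : realType} {T : metricType R}.
Implicit Types (A E X : set T) (x : T).

(* Equal to -oo on the empty set. *)
Definition diam A : \bar R :=
  ereal_sup [set (mdist z.1 z.2)%:E | z in A `*` A].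

(* The empty set has weight 0 for s = 0 as well, so that finite covers may be
   padded with empty sets; a nonempty set of diameter 0 has weight 0 `^ 0 = 1
   for s = 0. *)
Definition diam_pow (s : R) A : \bar R :=
  if A == set0 then 0%E else (diam A `^ s)%E.

Definition hausdorff_content (s delta : R) A : \bar R :=
  ereal_inf [set (\sum_(0 <= i <oo) diam_pow s (F i))%E | F in
    [set F : nat -> set T | (forall i, (diam (F i) <= delta%:E)%E) /\
                            A `<=` \bigcup_i F i]].

Definition hausdorff_measure (s : R) A : \bar R :=
  ereal_sup [set hausdorff_content s delta A | delta in [set delta | 0 < delta]].

Definition dimH A : \bar R :=
  ereal_inf [set s%:E | s in [set s | 0 <= s /\ hausdorff_measure s A = 0%E]].

(* A subset X of T is regarded as a metric space with the induced metric: its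
   closed balls are the traces on X of those of T centred in X. *)
Definition cball X x (r : R) : set T := [set y | X y /\ mdist x y <= r].

(* The balls of diameter r are those of radius r / 2; the value is +oo if E has
   no finite cover by such balls. *)
Definition covering_number X (r : R) E : \bar R :=
  ereal_inf [set (size c)%:R%:E | c in
    [set c : seq T | (forall x, x \in c -> X x) /\
                     E `<=` \bigcup_(x in [set` c]) cball X x (r / 2)]].

Definition dimA_eps (eps : R) X : \bar R :=
  ereal_inf [set beta%:E | beta in
    [set beta : R | exists C : R, forall r rho : R,
       0 < r -> r <= r `^ (1 - eps) -> r `^ (1 - eps) <= rho ->
       (ereal_sup [set covering_number X r (cball X x rho) | x in X]
          <= (C * (rho / r) `^ beta)%:E)%E]].

Definition dimMA_eps (eps : R) X : \bar R :=
  ereal_inf [set ereal_sup (range (fun i => dimA_eps eps (F i))) | F in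
    [set F : nat -> set T | X = \bigcup_i F i]].

Definition dimMA X : \bar R :=
  ereal_sup [set dimMA_eps eps X | eps in [set eps | 0 < eps < 1]].

End dimensions.

Section percolation.
Context {R : realType}.

Definition dyadic (n : nat) : set (set R) :=
  [set `[p%:R * 2 ^- n, p.+1%:R * 2 ^- n]%classic | p in [set p | (p < 2 ^ n)%N]].

Context {d : measure_display} {Omega : measurableType d}.

Definition independent_events (P : probability Omega R) (I : choiceType)
    (D : set I) (E : I -> set Omega) : Prop :=
  (forall i, D i -> measurable (E i)) /\
  (forall J : {fset I}, [set` J] `<=` D ->
     P (\bigcap_(i in [set` J]) E i) = (\prod_(i <- J) P (E i))%E).

(* keep I is the event that the coin attached to the interval I says keep; the
   coins of all dyadic intervals of order >= 1 are tossed, but that of I is only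
   looked at when I is contained in the set obtained at the preceding step. *)
Definition percolation_coins (P : probability Omega R) (p : R)
    (keep : set R -> set Omega) : Prop :=
  let D := \bigcup_(n in [set n | (1 <= n)%N]) dyadic n in
  independent_events P D keep /\ (forall I, D I -> P (keep I) = p%:E).

(* Starting from Delta 0 = {[0, 1]} makes the first step of the construction an
   instance of the general one. *)
Fixpoint Delta (keep : set R -> set Omega) (n : nat) (w : Omega)
    : set (set R) :=
  if n is m.+1 then
    [set I | [/\ dyadic m.+1 I,
                 I `<=` \bigcup_(J in Delta keep m w) J & keep I w]]
  else dyadic 0.

Definition percolation_step (keep : set R -> set Omega) (n : nat) (w : Omega)
    : set R :=
  \bigcup_(I in Delta keep n w) I.

(* The metric structure of the real line is attached to the type R^o. *)
Definition percolation_limit (keep : set R -> set Omega) (w : Omega) : set R^o :=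
  \bigcap_(n in [set n | (1 <= n)%N]) percolation_step keep n w.

End percolation.

(* Main.v *)
Require Import Defs.
From mathcomp Require Import lra ring zify.

Set Implicit Arguments.
Unset Strict Implicit.
Unset Printing Implicit Defensive.

Import Order.TTheory GRing.Theory Num.Theory.
Import numFieldNormedType.Exports.

Local Open Scope classical_set_scope.
Local Open Scope ring_scope.

(** Put p = 2^-gamma.  A dyadic interval of order m is a vertex (m, q) of the
    binary tree, its children being (m+1, 2q) and (m+1, 2q+1); the intervals
    kept by the percolation form a Galton-Watson tree in which each of the two
    children of a vertex is kept with probability p, and the limit set is the
    set of points all of whose generations of dyadic intervals survive.  What
    happens in the first n generations below a vertex depends on finitely many
    coins, whose joint law is an explicit product (sample_event); so every
    probabilistic estimate is a computation with finite sums over coin trees of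
    height n, done by recursion on n, and the underlying probability space only
    enters through continuity of measures and the Borel-Cantelli lemma.

    Upper bound.  Fix b > 2p = 2^(1-gamma).  The number of descendants K
    generations below a vertex exceeds a multiple of b^K with a probability
    that is smaller than any given geometric rate in K (pop_tail), because the
    generating function of the population can be iterated slightly to the
    right of 1.  This beats the number of vertices of order at most L K, so
    almost surely all of those have at most C b^K descendants K generations
    later (pop_growth_ae).  In the definition of dim_A^eps the radius rho is at
    least r^(1-eps); if rho has order 2^-m and r has order 2^-n, then
    m <= L (n - m) as soon as L >= 1/eps, so the covering numbers are controlled
    for exactly the scales that matter (dimA_eps_le).  Hence dim_A^eps of the
    limit set is at most 1 - gamma for every eps, and so is dim_MA.

    Lower bound.  Let 0 < s < 1 - gamma and lam = 2^-s, so that 2 p lam > 1.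
    Imagine that the tree is thinned further, each edge being retained with
    probability lam, and let thin_surv be the conditional probability, given
    the coins, that the thinned tree reaches generation n.  Its mean satisfies a
    closed quadratic recursion, so it stays above a positive constant.  Its
    limit in n is at most 1 at every vertex and at most lam times the sum of its
    values at the kept children: it bounds from below what a flow through the
    tree can carry when an edge of generation m has capacity lam^m = (2^-m)^s,
    and so the Hausdorff content of the limit set is at least a multiple of it
    (hausdorff_content_ge).  It remains to see that the limit is positive
    whenever the tree survives.  The probability that it vanishes is less
    than 1 and at most its image under the generating function of the
    offspring, whose only fixed points are 1 and the extinction probability;
    hence it is the extinction probability (limit_surv_gt0_ae).

    Finally dim_H <= max(dim_MA, 0) for every bounded set (dimH_le_dimMA), since
    dim_A^eps bounds the number of small balls needed to cover each piece, and
    null sets for a Hausdorff measure are stable under countable unions. *)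

(** * Finite trees of coins *)

(** The outcomes of the coins in the first n generations below a vertex: for
    each of the two children, its coin and the outcomes below it. *)
Fixpoint coin_tree (n : nat) : finType :=
  if n is m.+1 then ((bool * coin_tree m) * (bool * coin_tree m))%type : finType
  else unit.

(** Here c m q is the coin of the vertex (m, q); the coin of the root (m, q) is
    not part of the tree below it. *)
Fixpoint sample (c : nat -> nat -> bool) (n m q : nat) : coin_tree n :=
  if n is k.+1 return coin_tree n then
    ((c m.+1 q.*2, sample c k m.+1 q.*2),
     (c m.+1 q.*2.+1, sample c k m.+1 q.*2.+1))
  else tt.

(** The size of the n-th generation, given that the root is alive. *)
Fixpoint pop (n : nat) : coin_tree n -> nat :=
  if n is k.+1 return coin_tree n -> nat then
    fun t => ((if t.1.1 then pop t.1.2 else 0) +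
              (if t.2.1 then pop t.2.2 else 0))%N
  else fun=> 1%N.

Section weights.
Context {R : realType}.
Variable p : R.
Hypothesis p01 : 0 <= p <= 1.

Definition coin_wt (b : bool) : R := if b then p else 1 - p.

Fixpoint tree_wt (n : nat) : coin_tree n -> R :=
  if n is k.+1 return coin_tree n -> R then
    fun t => coin_wt t.1.1 * tree_wt t.1.2 * (coin_wt t.2.1 * tree_wt t.2.2)
  else fun=> 1.

Definition tree_mean n (g : coin_tree n -> R) : R := \sum_t tree_wt t * g t.

Lemma coin_wt_ge0 b : 0 <= coin_wt b.
Proof. by case/andP: p01 => ? ?; case: b; rewrite /coin_wt ?subr_ge0. Qed.

Lemma tree_wt_ge0 n (t : coin_tree n) : 0 <= tree_wt t.
Proof.
elim: n t => [|n IH] //= t.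
by rewrite !mulr_ge0 ?coin_wt_ge0.
Qed.

(** The outcomes in the two subtrees are independent and identically
    distributed. *)
Lemma tree_meanM n (h k : bool * coin_tree n -> R) :
  tree_mean (fun t : coin_tree n.+1 => h t.1 * k t.2) =
  (p * tree_mean (fun t => h (true, t)) + (1 - p) * tree_mean (fun t => h (false, t))) *
  (p * tree_mean (fun t => k (true, t)) + (1 - p) * tree_mean (fun t => k (false, t))).
Proof.
have H (g : bool * coin_tree n -> R) :
    p * tree_mean (fun t => g (true, t)) + (1 - p) * tree_mean (fun t => g (false, t))
    = \sum_bt coin_wt bt.1 * tree_wt bt.2 * g bt.
  transitivity (\sum_(b : bool) \sum_(t : coin_tree n) coin_wt b * tree_wt t * g (b, t)).
    rewrite big_bool /= /tree_mean !mulr_sumr.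
    by congr (_ + _); apply: eq_bigr => t _; rewrite mulrA.
  by rewrite pair_bigA; apply: eq_bigr => -[].
rewrite !H /tree_mean big_distrlr /= pair_bigA /=; apply: eq_bigr => -[bt bu] _ /=.
by ring.
Qed.

Lemma tree_mean_le n (g h : coin_tree n -> R) :
  (forall t, g t <= h t) -> tree_mean g <= tree_mean h.
Proof. by move=> gh; apply: ler_sum => t _; rewrite ler_wpM2l ?tree_wt_ge0. Qed.

Lemma tree_mean1 n : tree_mean (fun _ : coin_tree n => 1) = 1.
Proof.
elim: n => [|n IH].
  have tt1 : xpredT =1 pred1 (tt : coin_tree 0) by move=> [].
  by rewrite /tree_mean (big_pred1 _ tt1) mulr1.
transitivity (tree_mean (fun _ : coin_tree n.+1 => 1 * 1)).
  by apply: eq_bigr => t _; rewrite !mulr1.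
by rewrite (tree_meanM (fun=> 1) (fun=> 1)) IH; ring.
Qed.

Lemma tree_meanD n (g h : coin_tree n -> R) :
  tree_mean (fun t => g t + h t) = tree_mean g + tree_mean h.
Proof. by rewrite /tree_mean -big_split; apply: eq_bigr => t _; rewrite mulrDr. Qed.

Lemma tree_meanZ n a (g : coin_tree n -> R) :
  tree_mean (fun t => a * g t) = a * tree_mean g.
Proof. by rewrite /tree_mean mulr_sumr; apply: eq_bigr => t _; ring. Qed.

Lemma tree_mean_cst n a : tree_mean (fun _ : coin_tree n => a) = a.
Proof.
by rewrite -[RHS]mulr1 -(tree_mean1 n) -tree_meanZ; apply: eq_bigr => t _; rewrite mulr1.
Qed.

Definition tree_prob n (A : pred (coin_tree n)) : R := \sum_(t | A t) tree_wt t.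

Lemma tree_probE n (A : pred (coin_tree n)) :
  tree_prob A = tree_mean (fun t => (A t)%:R).
Proof.
rewrite /tree_prob /tree_mean big_mkcond; apply: eq_bigr => t _.
by case: (A t); rewrite ?mulr1 ?mulr0.
Qed.

Lemma tree_prob_markov n (g : coin_tree n -> R) (A : pred (coin_tree n)) a :
  0 < a -> (forall t, 0 <= g t) -> (forall t, A t -> a <= g t) ->
  tree_prob A <= tree_mean g / a.
Proof.
move=> a0 g0 Ag; rewrite ler_pdivlMr // mulrC tree_probE -tree_meanZ.
by apply: tree_mean_le => t; case: (boolP (A t)) => [/Ag|_]; rewrite ?mulr1 ?mulr0.
Qed.

(** Generating function of a binomial offspring law with two trials. *)
Definition offspring_pgf x : R := (1 - p + p * x) ^+ 2.

(** The branching property in the multiplicative form that all the recursions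
    below use: extinction, generating functions and thinned survival are means
    of products over the kept children. *)
Lemma tree_mean_branch n (h : coin_tree n -> R) :
  tree_mean (fun t : coin_tree n.+1 =>
     (if t.1.1 then h t.1.2 else 1) * (if t.2.1 then h t.2.2 else 1)) =
  offspring_pgf (tree_mean h).
Proof.
rewrite (@tree_meanM _ (fun bt => if bt.1 then h bt.2 else 1)
                       (fun bt => if bt.1 then h bt.2 else 1)) /=.
have -> : tree_mean (fun=> 1 : R) = 1 := tree_mean1 n.
by rewrite /offspring_pgf; ring.
Qed.

Lemma extinct_probS n :
  tree_prob (fun t : coin_tree n.+1 => pop t == 0%N) =
  offspring_pgf (tree_prob (fun t : coin_tree n => pop t == 0%N)).
Proof.
rewrite !tree_probE -tree_mean_branch; apply: eq_bigr => -[[b0 t0] [b1 t1]] _ /=.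
congr (_ * _); rewrite addn_eq0.
by case: b0; case: b1; rewrite /= ?mulr1 ?mul1r //; case: eqP; case: eqP; rewrite /= ?mulr1 ?mulr0.
Qed.

Lemma pop_genS n s :
  tree_mean (fun t : coin_tree n.+1 => s ^+ pop t) =
  offspring_pgf (tree_mean (fun t : coin_tree n => s ^+ pop t)).
Proof.
rewrite -tree_mean_branch; apply: eq_bigr => -[[b0 t0] [b1 t1]] _ /=.
by congr (_ * _); rewrite exprD; case: b0; case: b1.
Qed.

(** One step of the recursion maps 1 + y to 1 + 2 p y + p^2 y^2, which is at
    most 1 + b y as long as y <= del.  The argument 1 + x is thus amplified by
    at most b in each generation, until it leaves the window of width del. *)
Lemma pop_gen_le (del b : R) n (x : R) :
  0 <= del -> 1 <= b -> 2 * p + p ^+ 2 * del <= b ->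
  0 <= x -> x * b ^+ n <= del ->
  tree_mean (fun t : coin_tree n => (1 + x) ^+ pop t) <= 1 + x * b ^+ n.
Proof.
move=> del0 b1 hb x0; have /andP[p0 p1] := p01; elim: n => [|n IH] hx.
  by rewrite (_ : (fun _ => _) = (fun=> 1 + x)) ?tree_mean_cst ?expr0 ?mulr1.
have b0 : 0 <= b by rewrite (le_trans ler01).
have hy : x * b ^+ n <= x * b ^+ n.+1.
  by rewrite ler_wpM2l // exprS ler_peMl ?exprn_ge0.
have {}IH := IH (le_trans hy hx).
rewrite pop_genS /offspring_pgf.
set y := x * b ^+ n in hy IH *.
have y0 : 0 <= y by rewrite mulr_ge0 // exprn_ge0.
set g := tree_mean _ in IH *.
have g0 : 0 <= g.
  by apply: sumr_ge0 => t _; rewrite mulr_ge0 ?tree_wt_ge0 ?exprn_ge0 ?addr_ge0.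
apply: (@le_trans _ _ ((1 + p * y) ^+ 2)).
  have pg0 : 0 <= p * g by rewrite mulr_ge0.
  have py0 : 0 <= p * y by rewrite mulr_ge0.
  rewrite ler_sqr ?nnegrE; try lra.
  have : p * g <= p * (1 + y) by apply: ler_wpM2l => //; lra.
  lra.
have yd : y <= del by rewrite (le_trans hy).
have -> : x * b ^+ n.+1 = b * y by rewrite /y exprS; ring.
have h2 : p ^+ 2 * y * y <= p ^+ 2 * del * y.
  by rewrite ler_wpM2r // ler_wpM2l // sqr_ge0.
have h3 : (2 * p + p ^+ 2 * del) * y <= b * y by rewrite ler_wpM2r.
by nra.
Qed.

End weights.

(** * Survival under an additional thinning *)

Section thin_surv.
Context {R : realType}.
Variables p lam : R.
Hypothesis p01 : 0 <= p <= 1.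
Hypothesis lam01 : 0 < lam < 1.

(** The probability, given the coins, that the root is still connected to
    generation n when every kept edge is retained with probability lam
    independently: the connection fails iff it fails through both children. *)
Fixpoint thin_surv (n : nat) : coin_tree n -> R :=
  if n is k.+1 return coin_tree n -> R then
    fun t => 1 - (if t.1.1 then 1 - lam * thin_surv t.1.2 else 1) *
                 (if t.2.1 then 1 - lam * thin_surv t.2.2 else 1)
  else fun=> 1.

Lemma thin_surv_bounds n (t : coin_tree n) : 0 <= thin_surv t <= 1.
Proof.
have /andP[l0 l1] := lam01.
elim: n t => [|n IH] /=; first by move=> _; rewrite ler01 lexx.
move=> [[b0 t0] [b1 t1]] /=.
have H (b : bool) (u : coin_tree n) : 0 <= (if b then 1 - lam * thin_surv u else 1) <= 1.
  by case: b; rewrite ?ler01 ?lexx //; have /andP[? ?] := IH u; nra.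
have /andP[h0 h1] := H b0 t0; have /andP[h2 h3] := H b1 t1.
set x := (if b0 then _ else _) in h0 h1 *; set y := (if b1 then _ else _) in h2 h3 *.
nra.
Qed.

(** The union bound over the two children.  Iterated, and combined with the
    bound by 1, it bounds the value at the root by the sum of lam^m over the
    vertices of any family that separates the root from generation n. *)
Lemma thin_surv_le_sum n (t : coin_tree n.+1) :
  thin_surv t <= lam * ((if t.1.1 then thin_surv t.1.2 else 0) +
                        (if t.2.1 then thin_surv t.2.2 else 0)).
Proof.
have /andP[l0 l1] := lam01.
case: t => -[b0 t0] [b1 t1] /=.
have /andP[h0 h1] := thin_surv_bounds t0; have /andP[h2 h3] := thin_surv_bounds t1.
case: b0; case: b1; rewrite ?mulr1 ?mul1r ?addr0 ?add0r; try lra.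
have : 0 <= (lam * thin_surv t0) * (lam * thin_surv t1) by rewrite !mulr_ge0 // ltW.
lra.
Qed.

Lemma thin_surv_ge_child n (t : coin_tree n.+1) :
  lam * (if t.1.1 then thin_surv t.1.2 else 0) <= thin_surv t /\
  lam * (if t.2.1 then thin_surv t.2.2 else 0) <= thin_surv t.
Proof.
have /andP[l0 l1] := lam01.
case: t => -[b0 t0] [b1 t1] /=.
have /andP[h0 h1] := thin_surv_bounds t0; have /andP[h2 h3] := thin_surv_bounds t1.
have g0 : 0 <= lam * thin_surv t0 <= 1 by nra.
have g1 : 0 <= lam * thin_surv t1 <= 1 by nra.
by case: b0; case: b1; rewrite ?mulr1 ?mul1r ?mulr0; split; nra.
Qed.

Lemma thin_surv_sample_noninc c n m q :
  thin_surv (sample c n.+1 m q) <= thin_surv (sample c n m q).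
Proof.
have /andP[l0 l1] := lam01.
elim: n m q => [|n IH] m q.
  by have /andP[] := thin_surv_bounds (sample c 1 m q).
have H (b : bool) m' q' : (if b then 1 - lam * thin_surv (sample c n m' q') else 1) <=
    (if b then 1 - lam * thin_surv (sample c n.+1 m' q') else 1).
  by case: b => //; apply: lerB => //; apply: ler_wpM2l; [exact: ltW|exact: IH].
have H0 (b : bool) m' q' : 0 <= (if b then 1 - lam * thin_surv (sample c n m' q') else 1).
  by case: b => //; have /andP[? ?] := thin_surv_bounds (sample c n m' q'); nra.
have E k : thin_surv (sample c k.+1 m q) = 1 -
    (if c m.+1 q.*2 then 1 - lam * thin_surv (sample c k m.+1 q.*2) else 1) *
    (if c m.+1 q.*2.+1 then 1 - lam * thin_surv (sample c k m.+1 q.*2.+1) else 1) by [].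
rewrite (E n.+1) (E n) lerB //; apply: ler_pM; [exact: H0..|exact: H|exact: H].
Qed.

Lemma extinct_thin_surv n (t : coin_tree n) : pop t = 0%N -> thin_surv t = 0.
Proof.
elim: n t => [|n IH] //= -[[b0 t0] [b1 t1]] /= /eqP.
rewrite addn_eq0 => /andP[/eqP h0 /eqP h1].
by case: b0 h0 => [/IH->|_]; case: b1 h1 => [/IH->|_]; rewrite ?mulr0 ?subr0 ?mulr1 ?subrr.
Qed.

(** Coins and thinning together are a percolation with parameter p lam. *)
Lemma thin_surv_meanS n :
  tree_mean p (@thin_surv n.+1) = 1 - (1 - p * lam * tree_mean p (@thin_surv n)) ^+ 2.
Proof.
have -> : tree_mean p (@thin_surv n.+1) =
  tree_mean p (fun t : coin_tree n.+1 => 1 + (-1) *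
    ((if t.1.1 then 1 - lam * thin_surv t.1.2 else 1) *
     (if t.2.1 then 1 - lam * thin_surv t.2.2 else 1))).
  by apply: eq_bigr => t _; rewrite mulN1r.
rewrite tree_meanD tree_meanZ (tree_mean_branch p (fun t => 1 - lam * thin_surv t)).
rewrite tree_mean_cst /offspring_pgf.
have -> : tree_mean p (fun t : coin_tree n => 1 - lam * thin_surv t) =
          1 - lam * tree_mean p (@thin_surv n).
  rewrite -mulNr -tree_meanZ -{2}(tree_mean_cst p n 1) -tree_meanD.
  by apply: eq_bigr => t _; rewrite mulNr.
by ring.
Qed.

(** With b = p lam, the map m |-> 1 - (1 - b m)^2 is monotone on [0, 1] and its
    positive fixed point (2 b - 1) / b^2 stays below all the means, which start
    at 1. *)
Lemma thin_surv_mean_ge : 1 < 2 * p * lam ->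
  exists2 th : R, 0 < th & forall n, th <= tree_mean p (@thin_surv n).
Proof.
have /andP[l0 l1] := lam01; have /andP[p0 p1] := p01.
set b := p * lam; rewrite -mulrA -/b => a1.
have b1 : b <= 1 by rewrite /b; nra.
have bn0 : b != 0 by apply/eqP => E; lra.
have b2 : 0 < b ^+ 2 by rewrite exprn_gt0 //; lra.
exists ((2 * b - 1) / b ^+ 2); first by rewrite divr_gt0 //; lra.
set th := _ / _.
have th1 : th <= 1.
  rewrite /th ler_pdivrMr // mul1r; have := sqr_ge0 (b - 1); rewrite expr2; lra.
elim=> [|n IH]; first by rewrite tree_mean_cst.
rewrite thin_surv_meanS -/b; set m := tree_mean _ _ in IH *.
have m1 : m <= 1.
  rewrite /m -(tree_mean1 p n); apply: tree_mean_le => // t.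
  by have /andP[] := thin_surv_bounds t.
have E : 1 - (1 - b * th) ^+ 2 = th by rewrite /th; field.
by rewrite -{1}E lerB // ler_sqr ?nnegrE; nra.
Qed.

Lemma thin_surv_small_prob n th eps : th <= tree_mean p (@thin_surv n) -> 0 <= eps ->
  tree_prob p (fun t : coin_tree n => thin_surv t < eps) <= 1 - th + eps.
Proof.
move=> hth e0; rewrite tree_probE.
have : tree_mean p (@thin_surv n) <=
  tree_mean p (fun t : coin_tree n => (1 + eps) + (-1) * (thin_surv t < eps)%R%:R).
  apply: tree_mean_le => // t; have /andP[? ?] := thin_surv_bounds t.
  by case: ltP => ?; rewrite ?mulr1 ?mulr0; lra.
rewrite tree_meanD tree_meanZ tree_mean_cst; lra.
Qed.

(** If the thinned survival is below eps at the root, it is below eps / lam at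
    every kept child. *)
Lemma thin_surv_small_probS n eps : 0 < eps ->
  tree_prob p (fun t : coin_tree n.+1 => thin_surv t < eps) <=
  offspring_pgf p (tree_prob p (fun t : coin_tree n => thin_surv t < eps / lam)).
Proof.
have /andP[l0 l1] := lam01 => e0.
rewrite !tree_probE -tree_mean_branch; apply: tree_mean_le => // -[[b0 t0] [b1 t1]].
move: (thin_surv_ge_child ((b0, t0), (b1, t1))) => /=; move: (1 - _ * _) => s [h0 h1].
have H u : lam * u <= s -> s < eps -> u < eps / lam.
  by move=> hu hs; rewrite ltr_pdivlMr // mulrC (le_lt_trans hu).
case: ltP => hs; last by case: b0 {h0}; case: b1 {h1}; rewrite ?mulr1 ?mul1r ?mulr_ge0.
by case: b0 h0 => [/H-> //|_]; case: b1 h1 => [/H-> //|_]; rewrite mulr1.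
Qed.

End thin_surv.

Lemma cvg_offspring_pgf (R : realType) (p l : R) (f : nat -> R) :
  f @ \oo --> l -> (fun n => offspring_pgf p (f n)) @ \oo --> offspring_pgf p l.
Proof.
move=> h; rewrite /offspring_pgf; under eq_fun do rewrite expr2; rewrite expr2.
by apply: cvgM; (apply: cvgD; [exact: cvg_cst | apply: cvgM => //; exact: cvg_cst]).
Qed.

(** The limit Q of u satisfies Q <= offspring_pgf Q, and
    offspring_pgf x - x = (x - 1) (p^2 x - (1 - p)^2) is negative strictly
    between its root e and 1; so Q < 1 forces Q <= e. *)
Lemma pgf_fixed_point_limit (R : realType) (p e : R) (u : nat -> R) :
  0 < p <= 1 -> 0 <= e -> offspring_pgf p e = e -> {homo u : m n / (m <= n)%N >-> n <= m} ->
  (forall k, e <= u k) -> (forall k, u k.+1 <= offspring_pgf p (u k)) ->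
  limn u < 1 -> u @ \oo --> e.
Proof.
move=> /andP[p0 p1] e0 fe nu eu hu lu1.
have cu : cvgn u.
  by apply: nonincreasing_is_cvgn => //; exists e => _ [k _ <-].
have lue : e <= limn u by apply: limr_ge => //; apply: nearW.
suff : limn u <= e by move=> h; rewrite (@le_anti _ _ e (limn u)) ?lue.
have Qf : limn u <= offspring_pgf p (limn u).
  have h1 : (fun n => u n.+1) @ \oo --> limn u by rewrite (cvg_shiftS u).
  have h2 := cvg_offspring_pgf (p := p) cu.
  by apply: (ler_cvg_to h1 h2); apply: nearW.
set Q := limn u in lu1 lue Qf *.
have F1 : (1 - Q) * (p ^+ 2 * Q - (1 - p) ^+ 2) <= 0.
  by move: Qf; rewrite /offspring_pgf -subr_ge0; nra.
have F2 : (1 - e) * (p ^+ 2 * e - (1 - p) ^+ 2) = 0.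
  by move: fe; rewrite /offspring_pgf => /eqP; rewrite -subr_eq0 => /eqP; nra.
have G1 : p ^+ 2 * Q <= (1 - p) ^+ 2 by nra.
have e1 : 1 - e != 0 by rewrite subr_eq0; apply/eqP => E; lra.
move/eqP: F2; rewrite mulf_eq0 (negbTE e1) /= subr_eq0 => /eqP F2.
by move: G1; rewrite -F2 ler_pM2l // exprn_gt0.
Qed.

(** * Dyadic intervals and surviving vertices *)

Section dyad.
Context {R : realType}.

Definition dyad (m q : nat) : set R := `[q%:R * 2 ^- m, q.+1%:R * 2 ^- m]%classic.

Lemma dyadE m q (x : R) : dyad m q x <-> q%:R <= x * 2 ^+ m <= q.+1%:R.
Proof.
rewrite /dyad /= in_itv /= ler_pdivrMr ?exprn_gt0 // ler_pdivlMr ?exprn_gt0 //.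
Qed.

(** The left endpoint of each interval lies in the other one, and so does the
    right endpoint. *)
Lemma dyad_inj m q m' q' : dyad m q = dyad m' q' -> m = m' /\ q = q'.
Proof.
have le2 : forall m q m' q', dyad m q = dyad m' q' ->
    q'%:R * 2 ^- m' <= q%:R * 2 ^- m :> R /\
    q.+1%:R * 2 ^- m <= q'.+1%:R * 2 ^- m' :> R.
  move=> {}m {}q {}m' {}q' E.
  have lr : q%:R * 2 ^- m <= q.+1%:R * 2 ^- m :> R.
    by rewrite ler_wpM2r ?invr_ge0 ?exprn_ge0 // ler_nat.
  have : dyad m q (q%:R * 2 ^- m) by rewrite /dyad /= in_itv /= lexx lr.
  have : dyad m q (q.+1%:R * 2 ^- m) by rewrite /dyad /= in_itv /= lexx lr.
  by rewrite E /dyad /= !in_itv /= => /andP[_ ?] /andP[? _].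
move=> E; have [a1 a2] := le2 _ _ _ _ E; have [b1 b2] := le2 _ _ _ _ (esym E).
have eL : q%:R * 2 ^- m = q'%:R * 2 ^- m' :> R by apply/le_anti; rewrite a1 b1.
have eR : q.+1%:R * 2 ^- m = q'.+1%:R * 2 ^- m' :> R by apply/le_anti; rewrite a2 b2.
have e2 : 2 ^- m = 2 ^- m' :> R.
  by move: eR; rewrite -(natr1 q) -(natr1 q') !mulrDl !mul1r eL => /addrI.
have em : m = m'.
  have : (2 ^ m)%N%:R = (2 ^ m')%N%:R :> R by rewrite !natrX; exact: invr_inj.
  by move/eqP; rewrite eqr_nat eqn_exp2l // => /eqP.
split=> //; move: eL; rewrite -e2 => /mulIf.
rewrite invr_eq0 expf_eq0 pnatr_eq0 andbF => /(_ isT) /eqP.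
by rewrite eqr_nat => /eqP.
Qed.

Lemma dyad_sub_half m q : dyad m.+1 q `<=` dyad m q./2.
Proof.
move=> x /dyadE /andP[h1 h2]; apply/dyadE.
have /andP[g1 g2] : (2 * q./2 <= q)%N && (q.+1 <= 2 * (q./2).+1)%N by apply/andP; lia.
rewrite -(ler_nat R) in g1; rewrite -(ler_nat R) in g2.
rewrite !natrM in g1 g2; rewrite exprS in h1 h2.
by apply/andP; split; lra.
Qed.

Lemma dyad_sub_div m k j : dyad (m + k) j `<=` dyad m (j %/ 2 ^ k).
Proof.
elim: k j => [|k IH] j; first by rewrite addn0 expn0 divn1.
rewrite addnS => x /dyad_sub_half /IH.
by rewrite -divn2 -divnMA -expnS.
Qed.

Lemma dyad_dist m q (x y : R) : dyad m q x -> dyad m q y -> `|x - y| <= 2 ^- m.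
Proof.
move=> /dyadE /andP[h1 h2] /dyadE /andP[h3 h4].
rewrite -[leRHS]mul1r ler_pdivlMr ?exprn_gt0 //.
rewrite -[X in _ * X]gtr0_norm ?exprn_gt0 // -normrM ler_norml mulrBl.
by rewrite -natr1 in h2 h4; apply/andP; split; lra.
Qed.

(** A set of diameter at most 2^-m meets at most five intervals of order m:
    those at index distance at most 2 from one of them. *)
Lemma dyad_near m q q' (x y : R) :
  dyad m q x -> dyad m q' y -> `|x - y| <= 2 ^- m -> (q' < q + 3)%N /\ (q < q' + 3)%N.
Proof.
move=> /dyadE /andP[h1 h2] /dyadE /andP[h3 h4].
rewrite -[X in _ <= X]mul1r ler_pdivlMr ?exprn_gt0 //.
rewrite -[X in _ * X]gtr0_norm ?exprn_gt0 // -normrM ler_norml mulrBl => /andP[h5 h6].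
by split; rewrite -(ltr_nat R) natrD; rewrite -natr1 in h2 h4; lra.
Qed.

(** The midpoint of an interval of order m+1 is interior to its parent, hence
    lies in no other closed interval of order m. *)
Lemma dyad_midpoint m q q' :
  dyad m q' (q.*2.+1%:R * 2 ^- m.+2) -> q' = q./2.
Proof.
move/dyadE; rewrite (_ : _ * 2 ^- _ * 2 ^+ m = q.*2.+1%:R / 4); last first.
  by rewrite !exprS; field; rewrite expf_neq0.
rewrite ler_pdivlMr // ler_pdivrMr // -!natrM !ler_nat; lia.
Qed.

Lemma dyad_midpoint_in m q : dyad m.+1 q (q.*2.+1%:R * 2 ^- m.+2).
Proof.
apply/dyadE; rewrite (_ : _ * 2 ^- _ * 2 ^+ m.+1 = q.*2.+1%:R / 2); last first.
  by rewrite !exprS; field; rewrite expf_neq0.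
rewrite ler_pdivlMr // ler_pdivrMr // -!natrM !ler_nat; lia.
Qed.

(** The parent of (m+1, q) is (m, q./2). *)
Fixpoint alive (c : nat -> nat -> bool) (m q : nat) : bool :=
  if m is k.+1 then alive c k q./2 && c m q else q == 0%N.

Lemma alive_lt c m q : alive c m q -> (q < 2 ^ m)%N.
Proof.
elim: m q => [|m IH] q /=; first by move/eqP->.
by case/andP => /IH; rewrite expnS; lia.
Qed.

Lemma alive_div c m k j : alive c (m + k) j -> alive c m (j %/ 2 ^ k).
Proof.
elim: k j => [|k IH] j; first by rewrite addn0 expn0 divn1.
by rewrite addnS /= => /andP[/IH + _]; rewrite -divn2 -divnMA -expnS.
Qed.

(** The descendants of (m, q), k generations later, whose coins and those of all
    vertices in between say keep; if (m, q) is alive, these are its alive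
    descendants. *)
Fixpoint desc (c : nat -> nat -> bool) (k m q : nat) : seq nat :=
  if k is l.+1 then
    (if c m.+1 q.*2 then desc c l m.+1 q.*2 else [::]) ++
    (if c m.+1 q.*2.+1 then desc c l m.+1 q.*2.+1 else [::])
  else [:: q].

Lemma size_desc c k m q : size (desc c k m q) = pop (sample c k m q).
Proof.
elim: k m q => [|k IH] m q //=.
by rewrite size_cat -!IH; case: ifP; case: ifP.
Qed.

Lemma mem_desc c k m j : alive c (m + k) j -> j \in desc c k m (j %/ 2 ^ k).
Proof.
elim: k m => [|k IH] m; first by rewrite expn0 divn1 /= inE.
rewrite addnS -addSn => aj; have := alive_div aj; have := IH _ aj.
rewrite expnSr divnMA /= divn2; set q := (j %/ _)%N => jq /andP[_ cq].
rewrite mem_cat; case: (boolP (odd q)) => oq.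
  have -> : (q./2).*2.+1 = q by rewrite -[RHS]odd_double_half oq.
  by rewrite cq jq orbT.
have -> : (q./2).*2 = q by rewrite -[RHS]odd_double_half (negbTE oq).
by rewrite cq jq.
Qed.

Lemma pop_bound n (t : coin_tree n) : (pop t <= 2 ^ n)%N.
Proof.
elim: n t => [|n IH] //= -[[b0 t0] [b1 t1]] /=.
by rewrite expnS mul2n -addnn leq_add //; [case: b0|case: b1].
Qed.

End dyad.

Section geometry.
Context {R : realType} {d : measure_display} {Omega : measurableType d}.
Variable keep : set R -> set Omega.

Definition coin (w : Omega) (m q : nat) : bool := `[< keep (dyad m q) w >].

(** Contained in the union of the intervals kept before means that the parent
    was kept, as the midpoint shows. *)
Lemma DeltaE w m : Delta keep m w = [set dyad m q | q in [set q | alive (coin w) m q]].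
Proof.
elim: m => [|m IH].
  apply/seteqP; split=> [I [q]|I [q]] /=; rewrite ?expn0.
    by rewrite ltnS leqn0 => /eqP -> <-; exists 0%N.
  by move=> /eqP -> <-; exists 0%N.
rewrite /= IH; apply/seteqP; split=> [I [[q /= qm <-] qI kI]|I [q /= /andP[aq cq] <-]].
  exists q => //=; apply/andP; split; last exact/asboolP.
  have /qI[_ [q' aq' <-] /dyad_midpoint <-] := @dyad_midpoint_in R m q.
  exact: aq'.
split.
- by exists q => //=; move/alive_lt: aq; rewrite expnS; lia.
- move=> x /dyad_sub_half hx; exists (dyad m q./2) => //.
  by exists (q./2).
- exact/asboolP.
Qed.

Lemma percolation_limitP w x : percolation_limit keep w x <->
  forall m, exists2 q, alive (coin w) m q & dyad m q x.
Proof.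
split=> [Gx m|H m _].
  have := Gx m.+1 isT; rewrite /percolation_step DeltaE => -[_ [q /= /andP[aq _] <-]].
  by move=> /dyad_sub_half qx; exists (q./2).
have [q aq qx] := H m; rewrite /percolation_step DeltaE.
by exists (dyad m q) => //; exists q.
Qed.

End geometry.

(** * The law of the coins below a vertex *)

(** The coins that the event that a sample equals a given tree prescribes, with
    their prescribed values. *)
Fixpoint toss_list (n m q : nat) : coin_tree n -> seq ((nat * nat) * bool) :=
  if n is k.+1 return coin_tree n -> _ then
    fun t => [:: ((m.+1, q.*2), t.1.1), ((m.+1, q.*2.+1), t.2.1)
             & toss_list m.+1 q.*2 t.1.2 ++ toss_list m.+1 q.*2.+1 t.2.2]
  else fun=> [::].

Definition below (m q : nat) (v : nat * nat) : bool :=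
  (m < v.1)%N && (v.2 %/ 2 ^ (v.1 - m) == q)%N.

Lemma below_child m q b v : (b < 2)%N ->
  below m.+1 (q.*2 + b) v -> below m q v.
Proof.
move=> b2 /andP[h1 /eqP h2]; apply/andP; split; first exact: ltnW.
have -> : (v.1 - m)%N = (v.1 - m.+1).+1 by lia.
by rewrite expnSr divnMA h2; apply/eqP; lia.
Qed.

Lemma toss_list_below n m q (t : coin_tree n) v :
  v \in unzip1 (toss_list m q t) -> below m q v.
Proof.
elim: n m q t => [|n IH] m q //= [[b0 t0] [b1 t1]] /=.
rewrite !inE => /or3P[/eqP->|/eqP->|].
- by rewrite /below /= subSn // subnn ltnSn /=; apply/eqP; lia.
- by rewrite /below /= subSn // subnn ltnSn /=; apply/eqP; lia.
rewrite /unzip1 map_cat mem_cat => /orP[] /IH h.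
  by apply: (@below_child m q 0); rewrite ?addn0.
by apply: (@below_child m q 1); rewrite ?addn1.
Qed.

Lemma toss_list_uniq n m q (t : coin_tree n) : uniq (unzip1 (toss_list m q t)).
Proof.
elim: n m q t => [|n IH] m q //= [[b0 t0] [b1 t1]] /=.
have nself q' (u : coin_tree n) q'' :
    (m.+1, q'') \notin unzip1 (toss_list m.+1 q' u).
  by apply/negP => /toss_list_below; rewrite /below /= ltnn.
rewrite /unzip1 map_cat -!/(unzip1 _) !inE !mem_cat !negb_or !nself cat_uniq !IH /=.
rewrite xpair_eqE eqxx /= ?andbT; apply/andP; split; first by apply/eqP; lia.
apply/hasPn => v /toss_list_below /andP[h1 /eqP h2]; apply/negP => /toss_list_below.
by move=> /andP[_ /eqP]; rewrite h2; lia.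
Qed.

Lemma sampleP c n m q (t : coin_tree n) :
  (sample c n m q == t) = all (fun vb => c vb.1.1 vb.1.2 == vb.2) (toss_list m q t).
Proof.
elim: n m q t => [|n IH] m q; first by case.
move=> [[b0 t0] [b1 t1]] /=.
rewrite all_cat -!IH !xpair_eqE.
by case: (c _ _ == b0); case: (c _ _ == b1); rewrite /= ?andbF.
Qed.

Section law.
Context {R : realType} {d : measure_display} {Omega : measurableType d}.
Variables (P : probability Omega R) (p : R) (keep : set R -> set Omega).
Hypothesis coinsP : percolation_coins P p keep.

Definition proper_vertex (v : nat * nat) := (0 < v.1)%N && (v.2 < 2 ^ v.1)%N.

Lemma proper_dyadic v : proper_vertex v ->
  (\bigcup_(n in [set n | (1 <= n)%N]) @dyadic R n) (dyad v.1 v.2).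
Proof. by case/andP => h1 h2; exists v.1 => //; exists v.2. Qed.

Lemma coin_measurable v : proper_vertex v ->
  measurable [set w | coin keep w v.1 v.2].
Proof.
move=> hv; have [[mk _] _] := coinsP.
rewrite (_ : [set _ | _] = keep (dyad v.1 v.2)); first exact/mk/proper_dyadic.
by apply/seteqP; split => w /= /asboolP.
Qed.

Lemma all_keep_prob (s : seq (nat * nat)) : uniq s -> all proper_vertex s ->
  P [set w | all (fun v => coin keep w v.1 v.2) s] = (p ^+ size s)%:E.
Proof.
move=> us ps; have [[mk ind] kp] := coinsP.
pose f (v : nat * nat) : set R := dyad v.1 v.2.
have finj : injective f by move=> [a b] [a' b'] /dyad_inj[/= -> ->].
pose J := [fset I in [seq f v | v <- s]]%fset.
have JD : [set` J] `<=` \bigcup_(n in [set n | (1 <= n)%N]) @dyadic R n.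
  move=> I /=; rewrite !inE => /mapP[v vs ->].
  by apply: proper_dyadic; exact: (allP ps).
have -> : [set w | all (fun v => coin keep w v.1 v.2) s] = \bigcap_(I in [set` J]) keep I.
  apply/seteqP; split => [w /= /allP aw I /=|w aw /=].
    by rewrite !inE => /mapP[v vs ->]; apply/asboolP; exact: aw.
  apply/allP => v vs; apply/asboolP; apply: aw => /=.
  by rewrite !inE; apply/mapP; exists v.
rewrite ind //.
have pe : perm_eq J [seq f v | v <- s].
  apply: uniq_perm; [exact: fset_uniq | by rewrite map_inj_uniq |].
  by move=> I; rewrite !inE.
rewrite (perm_big _ pe) /= big_map big_seq (eq_bigr (fun=> p%:E)); last first.
  by move=> v vs; apply/kp/proper_dyadic; exact: (allP ps).
rewrite -big_seq; elim: (s) => [|v l IH]; first by rewrite big_nil expr0.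
by rewrite big_cons IH exprS.
Qed.

(** Independence is only assumed for the events that coins say keep; a coin that
    says remove is traded for two events of smaller lists, P(A \ B) =
    P(A) - P(A and B), while the list s collects the coins that say keep. *)
Lemma tosses_law (l : seq ((nat * nat) * bool)) (s : seq (nat * nat)) :
  uniq (s ++ unzip1 l) -> all proper_vertex (s ++ unzip1 l) ->
  measurable [set w | all (fun v => coin keep w v.1 v.2) s &&
                      all (fun vb => coin keep w vb.1.1 vb.1.2 == vb.2) l] /\
  P [set w | all (fun v => coin keep w v.1 v.2) s &&
             all (fun vb => coin keep w vb.1.1 vb.1.2 == vb.2) l] =
  (p ^+ size s * \prod_(vb <- l) coin_wt p vb.2)%:E.
Proof.
elim: l s => [|[v b] l IH] s us ps.
  rewrite !cats0 in us ps; split; last first.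
    rewrite big_nil mulr1 -all_keep_prob //; congr (P _).
    by apply/seteqP; split => w /=; rewrite andbT.
  elim: s ps {us} => [|v s IH] /=.
    move=> _; rewrite (_ : [set _ | _] = setT); [exact: measurableT | exact/seteqP].
  case/andP => pv /IH ms; rewrite (_ : [set _ | _] =
    [set w | coin keep w v.1 v.2] `&` [set w | all (fun v => coin keep w v.1 v.2) s && true]).
    by apply: measurableI => //; exact: coin_measurable.
  by apply/seteqP; split => w /=; rewrite ?andbT => /andP.
have us' : uniq ((v :: s) ++ unzip1 l).
  by rewrite (perm_uniq (permEl (perm_catCA [:: v] s (unzip1 l)))).
have ps' : all proper_vertex ((v :: s) ++ unzip1 l).
  by move: ps; rewrite /= !all_cat /= => /and3P[-> -> ->].
have us2 : uniq (s ++ unzip1 l) by case/andP: us'.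
have ps2 : all proper_vertex (s ++ unzip1 l) by case/andP: ps'.
have [m1 e1] := IH _ us' ps'; have [m2 e2] := IH _ us2 ps2.
set A1 := [set w | _] in m1 e1; set A2 := [set w | _] in m2 e2.
have A12 : A1 `<=` A2 by move=> w /= /andP[/andP[_ ? ] ?]; apply/andP.
rewrite big_cons /=; case: b {us ps}; rewrite /coin_wt.
  rewrite (_ : [set w | _] = A1).
    by split=> //; rewrite e1 exprS; congr EFin; rewrite /=; ring.
  by apply: eq_set => w; rewrite /= eqb_id andbCA andbA.
rewrite (_ : [set w | _] = A2 `\` A1); last first.
  apply/seteqP; split => w /=; rewrite /A1 /A2 /=.
    by case: coin; rewrite ?andbF //= => /andP[-> ->].
  by case: coin; rewrite /= => -[-> //]; rewrite ?andbT // => /(_ isT).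
split; first exact: measurableD.
rewrite measureD //; last by rewrite (le_lt_trans (probability_le1 P m2)) // ltry.
rewrite (setIidr A12); move: e1 e2 => /= -> ->.
by rewrite -EFinB; congr EFin; rewrite exprS; ring.
Qed.

Lemma sample_law n m q (t : coin_tree n) : (q < 2 ^ m)%N ->
  measurable [set w | sample (coin keep w) n m q = t] /\
  P [set w | sample (coin keep w) n m q = t] = (tree_wt p t)%:E.
Proof.
move=> qm.
have hp : all proper_vertex (unzip1 (toss_list m q t)).
  apply/allP => v /toss_list_below /andP[h1 /eqP h2]; apply/andP; split; first lia.
  move: qm; rewrite -h2 ltn_divLR ?expn_gt0 // -expnD.
  by rewrite subnKC // ltnW.
have [] := @tosses_law (toss_list m q t) [::] (toss_list_uniq m q t) hp.
rewrite (_ : [set w | _] = [set w | sample (coin keep w) n m q = t]); last first.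
  by apply/seteqP; split => w /=; [rewrite -sampleP => /eqP | move=> /eqP; rewrite sampleP].
move=> h1 ->; split => //; rewrite expr0 mul1r; congr EFin.
elim: n m q t {qm hp h1} => [|n IH] m q t /=; first by rewrite big_nil.
by rewrite !big_cons big_cat /= !IH; ring.
Qed.

(** The bridge from the probability space to finite sums; the law does not
    depend on the vertex. *)
Lemma sample_event n m q (A : pred (coin_tree n)) : (q < 2 ^ m)%N ->
  measurable [set w | A (sample (coin keep w) n m q)] /\
  P [set w | A (sample (coin keep w) n m q)] = (tree_prob p A)%:E.
Proof.
move=> qm.
have H (l : seq (coin_tree n)) : uniq l ->
    measurable [set w | sample (coin keep w) n m q \in l] /\
    P [set w | sample (coin keep w) n m q \in l] = (\sum_(t <- l) tree_wt p t)%:E.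
  elim: l => [|t l IH] /= => [_|/andP[tl /IH[ml el]]].
    rewrite big_nil (_ : [set _ | _] = set0); last by apply/seteqP; split.
    by rewrite measure0; split=> //; exact: measurable0.
  have [mt et] := sample_law t qm.
  rewrite (_ : [set w | _] = [set w | sample (coin keep w) n m q = t] `|`
                             [set w | sample (coin keep w) n m q \in l]); last first.
    apply/seteqP; split => w /=; rewrite inE; first by move=> /orP[/eqP|]; [left|right].
    by case=> [->|->]; rewrite ?eqxx ?orbT.
  split; first exact: measurableU.
  rewrite measureU //; last by apply/seteqP; split => // w /= [-> h]; rewrite h in tl.
  by rewrite big_cons EFinD; congr (_ + _)%E.
have [] := H (enum A) (enum_uniq A).
rewrite (_ : [set w | _] = [set w | A (sample (coin keep w) n m q)]); last first.
  by apply/seteqP; split => w /=; rewrite mem_enum.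
by rewrite big_enum.
Qed.

End law.

(** * Hausdorff dimension and modified Assouad dimension *)

Section hausdorff.
Context {R : realType} {T : metricType R}.
Implicit Types A X : set T.

Lemma diam_le A (r : R) : (forall x y, A x -> A y -> mdist x y <= r) -> (diam A <= r%:E)%E.
Proof. by move=> h; apply: ge_ereal_sup => _ [[x y] [/= Ax Ay] <-]; rewrite lee_fin h. Qed.

Lemma diam_set0 : diam (set0 : set T) = -oo%E.
Proof. by rewrite /diam setX0 image_set0 ereal_sup0. Qed.

Lemma diam_pow_set0 (s : R) : diam_pow s (set0 : set T) = 0%E.
Proof. by rewrite /diam_pow eqxx. Qed.

Lemma diam_pow_ge0 (s : R) A : (0 <= diam_pow s A)%E.
Proof. by rewrite /diam_pow; case: ifP => // _; exact: poweR_ge0. Qed.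

Lemma diam_pow_le (s r : R) A : 0 <= s -> 0 <= r -> (diam A <= r%:E)%E ->
  (diam_pow s A <= (r `^ s)%:E)%E.
Proof.
move=> s0 r0 dA; rewrite /diam_pow; case: eqP => [_|/eqP/set0P[x Ax]].
  by rewrite lee_fin powR_ge0.
have d0 : (0 <= diam A)%E by apply: ereal_sup_ubound; exists (x, x) => //=; rewrite mdistxx.
case: (diam A) d0 dA => [d| |] //; rewrite !lee_fin => d0 dr.
by apply: ge0_ler_powR; rewrite ?nnegrE.
Qed.

(** A cover-wise form of being null for the s-dimensional Hausdorff measure. *)
Definition small_covers (s : R) A := forall delta e : R, 0 < delta -> 0 < e ->
  exists F : nat -> set T, [/\ forall i, (diam (F i) <= delta%:E)%E,
    A `<=` \bigcup_i F i & (\sum_(0 <= i <oo) diam_pow s (F i) <= e%:E)%E].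

Lemma small_covers_bigcup (s : R) (A : nat -> set T) :
  (forall i, small_covers s (A i)) -> small_covers s (\bigcup_i A i).
Proof.
move=> hA delta e d0 e0.
have h i : exists F : nat -> set T, [/\ forall k, (diam (F k) <= delta%:E)%E,
    A i `<=` \bigcup_k F k &
    (\sum_(0 <= k <oo) diam_pow s (F k) <= (e / (2 ^ i.+1)%:R)%:E)%E].
  by apply: hA => //; rewrite divr_gt0 // ltr0n expn_gt0.
have [F hF] := choice h.
have /card_esym/ppcard_eqP[f] := card_nat2.
exists (fun n => F (f n).1 (f n).2); split.
- by move=> n; have [] := hF (f n).1.
- move=> x [i _ Aix]; have [_ /(_ _ Aix) [k _ Fx] _] := hF i.
  by exists (f^-1%FUN (i, k)) => //=; rewrite invK ?inE.
rewrite nneseries_esumT; last by move=> n; exact: diam_pow_ge0.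
rewrite -(reindex_esum [set: nat] [set: nat * nat] f (fun v => diam_pow s (F v.1 v.2))) //.
rewrite (_ : setT = setT `*`` (fun=> setT)); last by apply/seteqP; split.
rewrite -(@esum_esum _ _ _ setT (fun=> setT) (fun i k => diam_pow s (F i k))); last first.
  by move=> i k _ _; exact: diam_pow_ge0.
rewrite -nneseries_esumT; last by move=> i; apply: esum_ge0 => k _; exact: diam_pow_ge0.
apply: le_trans (epsilon_trick0 xpredT (ltW e0)).
apply: lee_nneseries => [i _ _|i _]; first by apply: esum_ge0 => k _; exact: diam_pow_ge0.
by rewrite -nneseries_esumT; [have [] := hF i | move=> k; exact: diam_pow_ge0].
Qed.

Lemma small_covers_null (s : R) A : small_covers s A -> hausdorff_measure s A = 0%E.
Proof.
move=> h; apply/le_anti/andP; split.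
  apply: ge_ereal_sup => _ [delta /= d0 <-]; apply/lee_addgt0Pr => e e0; rewrite add0e.
  have [F [dF AF sF]] := h _ _ d0 e0.
  by apply: le_trans sF; apply: ereal_inf_lbound; exists F.
apply: (@le_trans _ _ (hausdorff_content s 1 A)).
  by apply: le_ereal_inf_tmp => _ [F _ <-]; apply: nneseries_ge0 => *; exact: diam_pow_ge0.
by apply: ereal_sup_ubound; exists 1; first exact: ltr01.
Qed.

(** With beta < s as in the definition of dim_A^eps and rho the fixed bound D on
    the diameter, A is covered by C (D / r)^beta + 1 balls of diameter at
    most r, of total weight O(r^(s - beta) + r^s), which tends to 0 with r. *)
Lemma small_covers_dimA (s eps D : R) A : 0 < s -> 0 < eps < 1 -> 1 <= D ->
  (forall x y, A x -> A y -> mdist x y <= D) -> (dimA_eps eps A < s%:E)%E ->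
  small_covers s A.
Proof.
move=> s0 /andP[e0 e1] D1 AD dA delta e d0 he.
have [->|/set0P[x Ax]] := eqVneq A set0.
  exists (fun=> set0); split => // [_|]; first by rewrite diam_set0 leNye.
  by rewrite eseries0 ?lee_fin ?(ltW he) // => i _ _; exact: diam_pow_set0.
have [_ [beta [C hC] <-]] := ereal_inf_lt dA; rewrite lte_fin => bs.
have [r [r0 r1 rd hr]] : exists r, [/\ 0 < r, r <= 1, r <= delta &
    (C * (D / r) `^ beta + 1) * r `^ s <= e].
  have sb : 0 < s - beta by rewrite subr_gt0.
  have K0 : 0 < `|C * D `^ beta| + 1 by rewrite ltr_wpDl.
  have t0 : 0 < e / 2 / (`|C * D `^ beta| + 1) by rewrite !divr_gt0.
  have e2 : 0 < e / 2 by rewrite divr_gt0.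
  near (0 : R)^'+ => r.
  have r0 : 0 < r by near: r; exact: nbhs_right_gt.
  exists r; split => //.
  - by near: r; exact: nbhs_right_le.
  - by near: r; exact: nbhs_right_le.
  have h1 : r `^ (s - beta) <= e / 2 / (`|C * D `^ beta| + 1).
    near: r; exact: (cvgr_le _ (powR_cvg0 sb) _ t0).
  have h2 : r `^ s <= e / 2 by near: r; exact: (cvgr_le _ (powR_cvg0 s0) _ e2).
  have D0 : 0 <= D by lra.
  have -> : (C * (D / r) `^ beta + 1) * r `^ s = C * D `^ beta * r `^ (s - beta) + r `^ s.
    rewrite mulrDl mul1r powRM ?invr_ge0 ?(ltW r0) // -(powR_inv1 (ltW r0)) -powRrM mulN1r.
    by rewrite powRD ?(gt_eqF r0) ?implybT //; ring.
  rewrite ler_pdivlMr // in h1.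
  have : C * D `^ beta * r `^ (s - beta) <= (`|C * D `^ beta| + 1) * r `^ (s - beta).
    rewrite ler_wpM2r ?powR_ge0 // (le_trans (ler_norm _)) // lerDl //.
  lra.
have cov : (covering_number A r A < (C * (D / r) `^ beta + 1)%:E)%E.
  apply: (@le_lt_trans _ _ (C * (D / r) `^ beta)%:E); last by rewrite lte_fin ltrDl.
  apply: le_trans (hC r D r0 _ _).
  - apply: ereal_sup_ubound; exists x => //.
    by congr covering_number; apply/seteqP; split => [y []//|y Ay]; split => //; exact: AD.
  - by apply: ger1_powR; [rewrite r0 r1 | lra].
  - apply: le_trans D1; rewrite -[leRHS](powRr0 r).
    by apply: ger_powR; [rewrite r0 r1 | lra].
have [_ [l [lA Al] <-] sl] := ereal_inf_lt cov; rewrite lte_fin in sl.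
pose F k := if (k < size l)%N then cball A (nth x l k) (r / 2) else set0.
have dF k : (diam (F k) <= r%:E)%E.
  rewrite /F; case: ifP => _; last by rewrite diam_set0 leNye.
  apply: diam_le => y z [_ hy] [_ hz].
  by rewrite (le_trans (metric_triangle y (nth x l k) z)) // metric_sym [leRHS]splitr lerD.
exists F; split.
- by move=> k; apply: le_trans (dF k) _; rewrite lee_fin.
- move=> y /Al [z zl yz]; have zi : (index z l < size l)%N by rewrite index_mem.
  by exists (index z l) => //; rewrite /F zi nth_index.
rewrite (nneseries_split 0 (size l)); last by move=> k _; exact: diam_pow_ge0.
rewrite [X in (_ + X)%E]eseries0 ?adde0; last first.
  by move=> k; rewrite add0n /F ltnNge => -> _; exact: diam_pow_set0.
apply: (@le_trans _ _ (\sum_(0 <= k < 0 + size l) (r `^ s)%:E)%E).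
  by apply: lee_sum => k _; apply: diam_pow_le; rewrite ?(ltW s0) ?(ltW r0).
rewrite sumEFin lee_fin sumr_const_nat subn0 add0n; apply: le_trans hr.
by rewrite -mulr_natl ler_wpM2r ?powR_ge0 // ltW.
Unshelve. all: by end_near.
Qed.

(** The maximum with 0 accounts for the empty set, where dim_MA is -oo. *)
Lemma dimH_le_dimMA (D : R) X : (forall x y, X x -> X y -> mdist x y <= D) ->
  (dimH X <= maxe (dimMA X) 0)%E.
Proof.
move=> XD; rewrite leNgt; apply/negP => h.
have [s hs sX] : exists2 s : R, (maxe (dimMA X) 0 < s%:E)%E & (s%:E < dimH X)%E.
  have m0 : (0 <= maxe (dimMA X) 0)%E by rewrite le_max lexx orbT.
  move: m0 h; case: (maxe _ _) => [r| |] // r0; case: (dimH X) => [u| |] //.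
  - rewrite lte_fin => ru; exists ((r + u) / 2); rewrite lte_fin; lra.
  - by move=> _; exists (r + 1); rewrite ?ltry // lte_fin ltrDl.
move: hs; rewrite gt_max lte_fin => /andP[dX s0].
(* Any eps in (0, 1) serves here, as dim_MA is the supremum over eps. *)
have half01 : 0 < (2^-1 : R) < 1 by rewrite invr_gt0 ltr0n invf_lt1 ?ltr1n.
have dX2 : (dimMA_eps 2^-1 X < s%:E)%E.
  by apply: le_lt_trans dX; apply: ereal_sup_ubound; exists 2^-1.
have [_ [F XF <-] hF] := ereal_inf_lt dX2.
have sc : small_covers s X.
  rewrite XF; apply: small_covers_bigcup => i.
  apply: (@small_covers_dimA s 2^-1 (Num.max D 1)) => //.
  - by rewrite le_max lexx orbT.
  - move=> x y Fx Fy; rewrite le_max XD // XF; by exists i.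
  - by apply: le_lt_trans hF; apply: ereal_sup_ubound; exists i.
have : (dimH X <= s%:E)%E.
  by apply: ereal_inf_lbound; exists s => //; split; [exact: ltW | exact: small_covers_null].
by rewrite leNgt sX.
Qed.

End hausdorff.

(** * Mass that the thinned survival puts on the tree *)

Section frostman.
Context {R : realType}.
Variables (lam : R) (c : nat -> nat -> bool).
Hypothesis lam01 : 0 < lam < 1.

(** The probability that the thinned tree below (m, q) is infinite. *)
Definition limit_surv (m q : nat) : R := limn (fun n => thin_surv lam (sample c n m q)).

Lemma cvg_limit_surv m q : (fun n => thin_surv lam (sample c n m q)) @ \oo --> limit_surv m q.
Proof.
have ni : {homo (fun n => thin_surv lam (sample c n m q)) : i j / (i <= j)%N >-> j <= i}.
  by apply/nonincreasing_seqP => n; exact: thin_surv_sample_noninc.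
apply: nonincreasing_is_cvgn => //.
by exists 0 => _ [n _ <-]; have /andP[] := thin_surv_bounds lam01 (sample c n m q).
Qed.

Lemma limit_surv_le1 m q : limit_surv m q <= 1.
Proof.
apply: limr_le; first exact: cvgP (@cvg_limit_surv m q).
by apply: nearW => n; have /andP[] := thin_surv_bounds lam01 (sample c n m q).
Qed.

Lemma limit_surv_le_sum m q : limit_surv m q <= lam *
  ((if c m.+1 q.*2 then limit_surv m.+1 q.*2 else 0) +
   (if c m.+1 q.*2.+1 then limit_surv m.+1 q.*2.+1 else 0)).
Proof.
have h1 : (fun n => thin_surv lam (sample c n.+1 m q)) @ \oo --> limit_surv m q.
  by rewrite (cvg_shiftS (fun n => thin_surv lam (sample c n m q))); exact: cvg_limit_surv.
have hc (b : bool) m' q' : (fun n => if b then thin_surv lam (sample c n m' q') else 0) @ \oo -->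
    (if b then limit_surv m' q' else 0).
  by case: b; [exact: cvg_limit_surv | exact: cvg_cst].
have h2 : (fun n => lam * ((if c m.+1 q.*2 then thin_surv lam (sample c n m.+1 q.*2) else 0) +
    (if c m.+1 q.*2.+1 then thin_surv lam (sample c n m.+1 q.*2.+1) else 0))) @ \oo -->
    lam * ((if c m.+1 q.*2 then limit_surv m.+1 q.*2 else 0) +
    (if c m.+1 q.*2.+1 then limit_surv m.+1 q.*2.+1 else 0)).
  by apply: cvgM; [exact: cvg_cst | apply: cvgD; exact: hc].
apply: (ler_cvg_to h1 h2); apply: nearW => n.
exact: (thin_surv_le_sum lam01 (sample c n.+1 m q)).
Qed.

(** S m q is to be thought of as the total weight, relative to (m, q), of the
    members of a cover that lie below (m, q). *)
Variable S : nat -> nat -> \bar R.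
Hypothesis S_ge0 : forall m q, (0 <= S m q)%E.
Hypothesis S_super : forall m q, (lam%:E * (S m.+1 q.*2 + S m.+1 q.*2.+1) <= S m q)%E.

(** A vertex carrying more flow than the cover below it weighs has a kept child
    with the same property: the flow at a vertex is at most, and the weight of
    the cover at least, lam times the sum over the children. *)
Lemma uncovered_child m q : (S m q < (limit_surv m q)%:E)%E ->
  exists q', [/\ q'./2 = q, c m.+1 q' & (S m.+1 q' < (limit_surv m.+1 q')%:E)%E].
Proof.
move=> bad; apply: contrapT => H.
have K q' : q'./2 = q -> ((if c m.+1 q' then limit_surv m.+1 q' else 0)%:E <= S m.+1 q')%E.
  move=> hq; case: ifPn => // cq; rewrite leNgt; apply/negP => h.
  by apply: H; exists q'.
have /andP[l0 _] := lam01.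
have le1 : ((limit_surv m q)%:E <= lam%:E * (S m.+1 q.*2 + S m.+1 q.*2.+1))%E.
  apply: (@le_trans _ _ (lam *
  ((if c m.+1 q.*2 then limit_surv m.+1 q.*2 else 0) +
   (if c m.+1 q.*2.+1 then limit_surv m.+1 q.*2.+1 else 0)))%:E).
    by rewrite lee_fin; exact: limit_surv_le_sum.
  rewrite EFinM lee_pmul2l ?lte_fin // EFinD leeD // K //; first by rewrite doubleK.
  by rewrite /= uphalf_double.
by have := lt_le_trans bad (le_trans le1 (S_super m q)); rewrite ltxx.
Qed.

(** Following such children gives nested intervals around a point of the limit
    set none of whose intervals belongs to the cover. *)
Lemma uncovered_path : (S 0 0 < (limit_surv 0 0)%:E)%E ->
  exists x : R, exists f : nat -> nat, forall m,
    [/\ alive c m (f m), dyad m (f m) x & (S m (f m) < (limit_surv m (f m))%:E)%E].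
Proof.
move=> bad0.
pose T := {v : nat * nat | alive c v.1 v.2 /\ (S v.1 v.2 < (limit_surv v.1 v.2)%:E)%E}.
have step (v : T) : {w : T | (sval w).1 = (sval v).1.+1 /\ (sval w).2./2 = (sval v).2}.
  case: v => -[m q] /= [aq bq]; apply: cid.
  have [q' [hq cq bq']] := uncovered_child bq.
  have H : alive c m.+1 q' /\ (S m.+1 q' < (limit_surv m.+1 q')%:E)%E.
    by rewrite /= hq aq cq.
  by exists (exist _ (m.+1, q') H).
have v00 : {v : T | sval v = (0, 0)%N}.
  by exists (exist _ (0, 0)%N (conj (eqxx _ : alive c 0 0) bad0)).
pose v n := iter n (fun u => sval (step u)) (sval v00).
have v1 n : (sval (v n)).1 = n.
  elim: n => [|n IH]; first by rewrite /v /= (svalP v00).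
  by rewrite /v iterS; have [-> _] := svalP (step (v n)); rewrite -/(v n) IH.
have v2 n : (sval (v n.+1)).2./2 = (sval (v n)).2.
  by rewrite /v iterS; have [_ ->] := svalP (step (v n)).
pose f n := (sval (v n)).2.
have nest n k : (f (n + k)%N %/ 2 ^ k)%N = f n.
  elim: k => [|k IH]; first by rewrite addn0 expn0 divn1.
  by rewrite addnS expnS divnMA divn2 v2 IH.
have left_in n k : dyad n (f n) ((f (n + k)%N)%:R * 2 ^- (n + k) : R).
  rewrite -(nest n k); apply: (@dyad_sub_div R n k).
  apply/dyadE; rewrite divfK ?expf_neq0 // lexx /= ler_nat; exact: leqnSn.
(* The nested intervals meet in the supremum of their left endpoints. *)
pose L := [set ((f n)%:R * 2 ^- n : R) | n in setT].
have Lub n : ubound L ((f n).+1%:R * 2 ^- n).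
  move=> _ [k _ <-]; have [nk|/ltnW kn] := leqP n k.
    have := left_in n (k - n)%N; rewrite subnKC //.
    by rewrite /dyad /= in_itv /= => /andP[].
  apply: (@le_trans _ _ ((f n)%:R * 2 ^- n)).
    have := left_in k (n - k)%N; rewrite subnKC //.
    by rewrite /dyad /= in_itv /= => /andP[].
  by rewrite ler_wpM2r ?invr_ge0 ?exprn_ge0 // ler_nat.
exists (sup L), f => m; have := svalP (v m); rewrite v1 -/(f m) => -[am bm]; split=> //.
rewrite /dyad /= in_itv /=; apply/andP; split.
  by apply: ub_le_sup; [exists ((f 0).+1%:R * 2 ^- 0); exact: Lub | exists m].
by apply: ge_sup => //; exists ((f 0)%:R * 2 ^- 0), 0%N.
Qed.

End frostman.

(** * Hausdorff content of the limit set *)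

Lemma ltr_powR_gt1 (R : realType) (a x y : R) : 1 < a -> x < y -> a `^ x < a `^ y.
Proof.
move=> a1 xy; rewrite /powR gt_eqF ?(lt_trans ltr01) //= ltr_expR ltr_pM2r // ln_gt0 //.
Qed.

(** In this part lam >= 1/2, the value at exponent 1; it makes an interval of
    order n+1 weigh at least half as much as one of order n. *)
Section content.
Context {R : realType}.
Variables (lam : R) (c : nat -> nat -> bool).
Hypothesis lam_half : 2^-1 <= lam < 1.

Let lam01 : 0 < lam < 1.
Proof. by case/andP: lam_half => h ->; rewrite andbT (lt_le_trans _ h) // invr_gt0. Qed.

Definition under (n m q q' : nat) : bool := (m <= n)%N && (q' %/ 2 ^ (n - m) == q)%N.

Definition hits (A : set R) (n q : nat) : bool := `[< dyad n q `&` A !=set0 >].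

Definition hit_number (A : set R) (n m q : nat) : nat :=
  count (fun q' => under n m q q' && hits A n q') (iota 0 (2 ^ n)).

(** Weight, relative to (m, q), of the intervals of order n below (m, q) that
    meet A. *)
Definition hit_weight (A : set R) (n m q : nat) : R :=
  lam ^+ (n - m) * (hit_number A n m q)%:R.

Lemma hit_weight_ge0 A n m q : 0 <= hit_weight A n m q.
Proof. by case/andP: lam01 => /ltW l0 _; rewrite mulr_ge0 ?exprn_ge0. Qed.

Lemma hit_weight_super A n m q :
  lam * (hit_weight A n m.+1 q.*2 + hit_weight A n m.+1 q.*2.+1) <= hit_weight A n m q.
Proof.
rewrite /hit_weight -mulrDr -natrD mulrA -exprS.
have [mn|nm] := ltnP m n; last first.
  have Z q' : hit_number A n m.+1 q' = 0%N.
    rewrite /hit_number (@eq_count _ _ pred0) ?count_pred0 // => k.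
    by rewrite /under ltnNge nm.
  by rewrite !Z mulr0; exact: hit_weight_ge0.
have -> : (n - m.+1).+1 = (n - m)%N by lia.
case/andP: lam01 => l0 _.
rewrite ler_wpM2l ?exprn_ge0 ?ler_nat ?(ltW l0) //.
pose a1 q' := under n m.+1 q.*2 q' && hits A n q'.
pose a2 q' := under n m.+1 q.*2.+1 q' && hits A n q'.
change (count a1 (iota 0 (2 ^ n)) + count a2 (iota 0 (2 ^ n)) <= hit_number A n m q)%N.
rewrite -count_predUI.
have -> : count (predI a1 a2) (iota 0 (2 ^ n)) = 0%N.
  rewrite (@eq_count _ _ pred0) ?count_pred0 // => k; apply/negP.
  by rewrite /= /a1 /a2 => /andP[/andP[/andP[_ /eqP h1] _] /andP[/andP[_ /eqP h2] _]]; lia.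
rewrite addn0.
apply: sub_count => k /=.
have E : (n - m)%N = (n - m.+1).+1 by lia.
case/orP => /andP[/andP[h1 /eqP h2] ->]; rewrite andbT /under (ltnW h1) /= E expnSr divnMA h2;
  apply/eqP; lia.
Qed.

Lemma hit_number_le A n m q : (diam (A : set R^o) <= (2 ^- n)%:E)%E -> (hit_number A n m q <= 5)%N.
Proof.
move=> dA; rewrite /hit_number -size_filter; set l := seq.filter _ _.
case: (posnP (size l)) => [->//|]; case El : l => [//|q0 l0] _; rewrite -El.
have ul : uniq l by rewrite filter_uniq ?iota_uniq.
have hl k : k \in l -> hits A n k by rewrite mem_filter => /andP[/andP[]].
have q0l : q0 \in l by rewrite El mem_head.
have /asboolP[x [q0x Ax]] := hl _ q0l.
rewrite -(size_iota (q0 - 2) 5); apply: uniq_leq_size => // k /hl /asboolP[y [ky Ay]].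
have [] := dyad_near q0x ky; last by rewrite mem_iota; lia.
rewrite -lee_fin; apply: le_trans dA; apply: ereal_sup_ubound.
by exists (x, y) => //=; rewrite distrC.
Qed.

Lemma hit_weight_covered A n q x : (q < 2 ^ n)%N -> dyad n q x -> A x -> 1 <= hit_weight A n n q.
Proof.
move=> qn qx Ax; rewrite /hit_weight subnn expr0 mul1r ler1n -has_count.
apply/hasP; exists q; first by rewrite mem_iota.
by rewrite /under leqnn subnn expn0 divn1 eqxx /=; apply/asboolP; exists x.
Qed.

Lemma powR_half_expn (t : R) k : (2 ^- k) `^ t = (2 `^ (- t)) ^+ k.
Proof.
rewrite -powR_invn // -powRrM -(powR_mulrn _ (powR_ge0 _ _)) -powRrM.
by congr (_ `^ _); ring.
Qed.

(** The order of the dyadic intervals that replace a member A of a cover: the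
    one comparable to its diameter, or, when A is empty or a point, one so
    large that the weight is at most e. *)
Lemma scale_exists (t e : R) (A : set R^o) : 0 <= t -> lam <= 2 `^ (- t) -> 0 < e ->
  (diam A <= 1%:E)%E ->
  exists n : nat, (diam A <= (2 ^- n)%:E)%E /\ ((lam ^+ n)%:E <= 2%:E * diam_pow t A + e%:E)%E.
Proof.
move=> t0 ht e0 dA1; have /andP[l0 l1] := lam01.
have dp0 : (0 <= diam_pow t A)%E by exact: diam_pow_ge0.
have [d0|d0] := leP (diam A) 0%E.
  have : (fun n => lam ^+ n) @ \oo --> (0 : R) by apply: cvg_expr; rewrite ger0_norm // ltW.
  move=> /cvgrPdist_lt /(_ _ e0) [N _ /(_ N (leqnn N))].
  rewrite /= sub0r normrN ger0_norm ?exprn_ge0 ?(ltW l0) // => lN.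
  exists N; split; first by rewrite (le_trans d0) // lee_fin invr_ge0 exprn_ge0.
  rewrite -[leLHS]add0e; apply: leeD; last by rewrite lee_fin ltW.
  by apply: mule_ge0 => //; rewrite lee_fin.
have : exists2 r : R, diam A = r%:E & 0 < r <= 1.
  move: d0 dA1; case: (diam A) => [r| |] //; rewrite lte_fin lee_fin => r0 r1.
  by exists r => //; rewrite r0.
case=> r rE /andP[r0 r1].
have ex : exists n, 2 ^- n.+1 < r.
  have : (fun n => 2^-1 ^+ n) @ \oo --> (0 : R).
    by apply: cvg_expr; rewrite ger0_norm ?invr_ge0 // invf_lt1 ?ltr1n.
  move=> /cvgrPdist_lt /(_ _ r0) [N _ /(_ N.+1 (leqnSn N))].
  by rewrite /= sub0r normrN ger0_norm ?exprn_ge0 ?invr_ge0 // exprVn => ?; exists N.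
case: (ex_minnP ex) => n rn nmin; exists n; rewrite rE; split.
  rewrite lee_fin leNgt; apply/negP; case: n nmin {rn} => [|n] nmin.
    by rewrite expr0 invr1 ltNge r1.
  by move=> /nmin; rewrite ltnn.
have -> : diam_pow t A = (r `^ t)%:E.
  rewrite /diam_pow; case: eqP => [A0|_]; last by rewrite rE poweR_EFin.
  by move: d0; rewrite A0 /diam setX0 image_set0 ereal_sup0.
rewrite -EFinM -EFinD lee_fin.
suff : lam ^+ n <= 2 * r `^ t by move/le_trans; apply; rewrite lerDl ltW.
apply: (@le_trans _ _ (2 * lam ^+ n.+1)).
  rewrite exprS mulrA -[leLHS]mul1r ler_wpM2r ?exprn_ge0 ?(ltW l0) //.
  by case/andP: lam_half => + _; rewrite -[X in X <= _]mul1r ler_pdivrMr // mulrC.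
rewrite ler_wpM2l // (@le_trans _ _ ((2 ^- n.+1) `^ t)) //.
  by rewrite powR_half_expn; apply: lerXn2r; rewrite ?nnegrE ?powR_ge0 ?(ltW l0).
by apply: ge0_ler_powR; rewrite ?nnegrE ?invr_ge0 ?exprn_ge0 ?(ltW r0) ?(ltW rn).
Qed.

(** Replacing each member of a cover by the at most 5 dyadic intervals of
    comparable size that meet it multiplies its weight by at most 5 * 2, up to
    a small error; if the content were below a twentieth of the mass of the
    root, uncovered_path would give an uncovered point of the limit set. *)
Lemma hausdorff_content_ge (t : R) (G : set R^o) : 0 <= t -> lam <= 2 `^ (- t) ->
  (forall x : R, (forall m, exists2 q, alive c m q & dyad m q x) -> G x) ->
  ((limit_surv lam c 0 0 / 20)%:E <= hausdorff_content t 1 G)%E.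
Proof.
move=> t0 ht HG; set th := limit_surv lam c 0 0.
apply: le_ereal_inf_tmp => _ [F [dF GF] <-]; rewrite leNgt; apply/negP => small.
have dp0 i : (0 <= diam_pow t (F i))%E by exact: diam_pow_ge0.
have th0 : 0 < th / 20.
  by rewrite -lte_fin; apply: le_lt_trans small; apply: nneseries_ge0 => i _ _; exact: dp0.
have [n hn] : {n : nat -> nat & forall i, (diam (F i) <= (2 ^- n i)%:E)%E /\
    ((lam ^+ n i)%:E <= 2%:E * diam_pow t (F i) + (th / 20 / (2 ^ i.+1)%:R)%:E)%E}.
  apply: (@choice _ _ (fun i ni => (diam (F i) <= (2 ^- ni)%:E)%E /\
    ((lam ^+ ni)%:E <= 2%:E * diam_pow t (F i) + (th / 20 / (2 ^ i.+1)%:R)%:E)%E)) => i.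
  by apply: scale_exists => //; rewrite divr_gt0 // ltr0n expn_gt0.
(* The total weight, relative to (m, q), of the dyadic intervals that replace
   the cover. *)
pose S m q : \bar R := (\sum_(0 <= i <oo) (hit_weight (F i) (n i) m q)%:E)%E.
have hw0 i m q : (0 <= (hit_weight (F i) (n i) m q)%:E)%E by rewrite lee_fin hit_weight_ge0.
have S_super m q : (lam%:E * (S m.+1 q.*2 + S m.+1 q.*2.+1) <= S m q)%E.
  rewrite /S -nneseriesD // -nneseriesZl; last by move=> i _; rewrite adde_ge0.
  apply: lee_nneseries => i _; last by rewrite -EFinD -EFinM lee_fin hit_weight_super.
  by rewrite mule_ge0 ?adde_ge0 // lee_fin ltW //; case/andP: lam01.
have S00 : (S 0%N 0%N < th%:E)%E.
  apply: (@le_lt_trans _ _ (\sum_(0 <= i <oo)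
      (5%:E * (2%:E * diam_pow t (F i) + (th / 20 / (2 ^ i.+1)%:R)%:E)))%E).
    apply: lee_nneseries => i _ //.
    have [h1 h2] := hn i; apply: (@le_trans _ _ (5%:E * (lam ^+ n i)%:E)%E); last first.
      by rewrite lee_pmul2l.
    have /andP[l0 _] := lam01.
    rewrite -EFinM lee_fin /hit_weight subn0 mulrC ler_wpM2r ?exprn_ge0 ?(ltW l0) //.
    by rewrite ler_nat hit_number_le.
  rewrite nneseriesZl; last first.
    by move=> i _; rewrite adde_ge0 ?mule_ge0 // lee_fin divr_ge0 // ltW.
  apply: (@le_lt_trans _ _ (5%:E * (\sum_(0 <= i <oo) (2%:E * diam_pow t (F i)) + (th / 20)%:E))%E).
    rewrite lee_pmul2l //; apply: epsilon_trick; last exact: ltW.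
    by move=> i; rewrite mule_ge0.
  rewrite nneseriesZl //; set s := (\sum_(_ <= _ <oo) _)%E in small *.
  have s0 : (0 <= s)%E by apply: nneseries_ge0 => i _ _; exact: dp0.
  case: s small s0 => [s| |] //; rewrite lte_fin lee_fin => sth s0.
  by rewrite -(EFinM 2 s) -(EFinD (2 * s)) -EFinM lte_fin; lra.
have [x [f hf]] :=
  uncovered_path lam01 (fun m q => nneseries_ge0 (fun i _ _ => hw0 i m q)) S_super S00.
have [i _ Fix_] : (\bigcup_i F i) x.
  by apply: GF; apply: HG => m; exists (f m); have [] := hf m.
have [/alive_lt fm fx] := hf (n i).
have S1 : (1%:E <= S (n i) (f (n i)))%E.
  apply: (@le_trans _ _ (hit_weight (F i) (n i) (n i) (f (n i)))%:E).
    by rewrite lee_fin (hit_weight_covered fm fx).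
  by rewrite /S (nneseriesD1 (n := i)) // leeDl // nneseries_ge0.
by move=> /(le_lt_trans S1); rewrite lte_fin ltNge limit_surv_le1.
Qed.

End content.

Lemma dimH_ge (R : realType) (s : R) (c : nat -> nat -> bool) (G : set R^o) :
  0 < s <= 1 -> 0 < limit_surv (2 `^ (- s)) c 0 0 ->
  (forall x : R, (forall m, exists2 q, alive c m q & dyad m q x) -> G x) ->
  (s%:E <= dimH G)%E.
Proof.
move=> /andP[s0 s1] th0 HG; apply: le_ereal_inf_tmp => _ [t [t0 Ht] <-].
rewrite lee_fin leNgt; apply/negP => ts.
have hlam : 2^-1 <= 2 `^ (- s) < (1 : R).
  rewrite -powR_inv1 // ler_powR ?ler1n ?lerN2 //=.
  by rewrite -[ltRHS](powRr0 2) ltr_powR_gt1 ?ltr1n // oppr_lt0.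
have lt : 2 `^ (- s) <= 2 `^ (- t) :> R by rewrite ler_powR ?ler1n // lerN2 ltW.
have := hausdorff_content_ge hlam t0 lt HG.
apply/negP; rewrite -ltNge; apply: (@le_lt_trans _ _ 0%E); last by rewrite lte_fin divr_gt0.
have : (hausdorff_content t 1 G <= hausdorff_measure t G)%E.
  by apply: ereal_sup_ubound; exists 1; first exact: ltr01.
by rewrite Ht.
Qed.

(** * Positive mass on survival *)

Lemma extinct_sampleS c n m q : pop (sample c n m q) = 0%N -> pop (sample c n.+1 m q) = 0%N.
Proof.
elim: n m q => [|n IH] m q //.
have E k : pop (sample c k.+1 m q) = ((if c m.+1 q.*2 then pop (sample c k m.+1 q.*2) else 0) +
   (if c m.+1 q.*2.+1 then pop (sample c k m.+1 q.*2.+1) else 0))%N by [].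
rewrite (E n.+1) (E n) => /eqP; rewrite addn_eq0 => /andP[/eqP h0 /eqP h1].
by case: ifP h0 => [_ /IH->|_ _]; case: ifP h1 => [_ /IH->|_ _].
Qed.

Section survival.
Context {R : realType} {d : measure_display} {Omega : measurableType d}.
Variables (P : probability Omega R) (p lam : R) (keep : set R -> set Omega).
Hypothesis coinsP : percolation_coins P p keep.
Hypothesis p01 : 0 < p <= 1.
Hypothesis lam01 : 0 < lam < 1.
Hypothesis supercritical : 1 < 2 * p * lam.

Let p01' : 0 <= p <= 1. Proof. by case/andP: p01 => /ltW -> ->. Qed.

Let X n w : coin_tree n := sample (coin keep w) n 0 0.
Let Ext n := [set w | pop (X n w) == 0%N].
Let B k n := [set w | thin_surv lam (X n w) < lam ^+ k].

Let prob_lim (E : forall n, pred (coin_tree n)) :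
  (forall n, [set w | E n (X n w)] `<=` [set w | E n.+1 (X n.+1 w)]) ->
  measurable (\bigcup_n [set w | E n (X n w)]) /\
  (fun n => tree_prob p (E n)) @ \oo --> fine (P (\bigcup_n [set w | E n (X n w)])).
Proof.
move=> hE; have q0 : (0 < 2 ^ 0)%N by [].
have mE n : measurable [set w | E n (X n w)] by have [] := sample_event coinsP (E n) q0.
have mU : measurable (\bigcup_n [set w | E n (X n w)]) by apply: bigcupT_measurable.
split=> //.
have h : P \o (fun n => [set w | E n (X n w)]) @ \oo -->
    (fine (P (\bigcup_n [set w | E n (X n w)])))%:E.
  rewrite fineK; last exact: fin_num_measure.
  apply: nondecreasing_cvg_mu => //.
  by apply/nondecreasing_seqP => n; exact/subsetPset/hE.
rewrite (_ : (fun n => tree_prob p (E n)) = fine \o (P \o (fun n => [set w | E n (X n w)]))).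
  exact: fine_cvg.
by apply/funext => n /=; have [_ ->] := sample_event coinsP (E n) q0.
Qed.

(** Let u k be the probability that the limiting thinned survival is below
    lam^k, and e the probability of extinction.  Both are limits of finite
    tree probabilities, so e is a fixed point of the generating function and
    u (k+1) <= offspring_pgf (u k); moreover u k is bounded away from 1, since
    the means are bounded away from 0.  Hence u k tends to e, and the event that
    the tree survives without mass is null. *)
Lemma limit_surv_gt0_ae : {ae P, forall w,
  (forall n, pop (sample (coin keep w) n 0 0) != 0%N) -> 0 < limit_surv lam (coin keep w) 0 0}.
Proof.
have /andP[l0 l1] := lam01; have /andP[p0 p1] := p01.
pose EE := \bigcup_n Ext n; pose BB k := \bigcup_n B k n.
have [mE cE] : measurable EE /\ (fun n => tree_prob p (fun t : coin_tree n => pop t == 0%N))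
    @ \oo --> fine (P EE).
  apply: (@prob_lim (fun n t => pop t == 0%N)) => n w /= /eqP h.
  by apply/eqP; exact: extinct_sampleS.
have mcB k : measurable (BB k) /\
  (fun n => tree_prob p (fun t : coin_tree n => thin_surv lam t < lam ^+ k))
    @ \oo --> fine (P (BB k)).
  apply: (@prob_lim (fun n t => thin_surv lam t < lam ^+ k)) => n w /=.
  by apply: le_lt_trans; exact: thin_surv_sample_noninc.
have EB k : EE `<=` BB k.
  by move=> w [n _ /= /eqP h]; exists n => //=; rewrite /B /= extinct_thin_surv // exprn_gt0.
have fP A : measurable A -> P A \is a fin_num by move=> mA; exact: fin_num_measure.
pose e := fine (P EE); pose u k := fine (P (BB k)).
have shift (f : nat -> R) (l : R) : f @ \oo --> l -> (fun n => f n.+1) @ \oo --> l.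
  by move=> h; rewrite (cvg_shiftS f).
have fe : offspring_pgf p e = e.
  have E : (fun n => offspring_pgf p (tree_prob p (fun t : coin_tree n => pop t == 0%N))) =
      (fun n => tree_prob p (fun t : coin_tree n.+1 => pop t == 0%N)).
    by apply/funext => n; rewrite extinct_probS.
  have := cvg_offspring_pgf (p := p) cE; rewrite E => h1.
  exact: (cvg_unique _ h1 (shift _ _ cE)).
have [th th0 hth] := thin_surv_mean_ge p01' lam01 supercritical.
have uB k : u k <= 1 - th + lam ^+ k.
  have [_ cB] := mcB k; rewrite /u -(cvg_lim _ cB) //.
  apply: limr_le; first exact: cvgP cB.
  by apply: nearW => n; apply: thin_surv_small_prob; rewrite ?exprn_ge0 // ltW.
have uni : {homo u : m n / (m <= n)%N >-> n <= m}.
  move=> m n mn; apply: fine_le; rewrite ?fP //; try by have [] := mcB m; have [] := mcB n.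
  apply: le_measure; rewrite ?inE; try by [have [] := mcB n|have [] := mcB m].
  move=> w [i _ /= h]; exists i => //=; apply: (lt_le_trans h).
  by apply: ler_wiXn2l => //; exact: ltW.
have ue : u @ \oo --> e.
  apply: (@pgf_fixed_point_limit _ p) => //.
  - by rewrite fine_ge0.
  - by move=> k; apply: fine_le; rewrite ?fP //; [have [] := mcB k|
      apply: le_measure; rewrite ?inE //; have [] := mcB k].
  - move=> k; have [_ cB] := mcB k; have [_ cB'] := mcB k.+1.
    apply: (ler_cvg_to (shift _ _ cB') (cvg_offspring_pgf (p := p) cB)); apply: nearW => n.
    have := thin_surv_small_probS p01' lam01 n (exprn_gt0 k.+1 l0).
    by rewrite exprSr mulfK // gt_eqF.
  have : (fun n => lam ^+ n) @ \oo --> (0 : R) by apply: cvg_expr; rewrite ger0_norm // ltW.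
  move=> /cvgrPdist_lt /(_ _ th0) [N _ /(_ N (leqnn N))].
  rewrite /= sub0r normrN ger0_norm ?exprn_ge0 ?(ltW l0) // => lN.
  apply: (@le_lt_trans _ _ (u N)); last by have := uB N; lra.
  apply: nonincreasing_cvgn_ge => //; apply: nonincreasing_is_cvgn => //.
  by exists 0 => _ [k _ <-]; rewrite fine_ge0.
(* Survival without mass means being in every BB k but not in EE. *)
exists (\bigcap_k (BB k `\` EE)).
have mN : measurable (\bigcap_k (BB k `\` EE)).
  by apply: bigcapT_measurable => k; apply: measurableD => //; have [] := mcB k.
split=> //.
  have hN k : (P (\bigcap_k (BB k `\` EE)) <= (u k - e)%:E)%E.
    have [mB _] := mcB k.
    apply: (@le_trans _ _ (P (BB k `\` EE))).
      by apply: le_measure; rewrite ?inE //; [exact: measurableD | exact: bigcap_inf].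
    rewrite measureD // ?(setIidr (EB k)); last by rewrite ltey_eq fP.
    by rewrite EFinB /u /e !fineK ?fP.
  apply/le_anti; rewrite measure_ge0 andbT -(fineK (fP _ mN)) lee_fin.
  have : (fun k => u k - e) @ \oo --> (0 : R).
    by rewrite -(subrr e); apply: cvgB => //; exact: cvg_cst.
  move=> h; rewrite -(cvg_lim _ h) //; apply: limr_ge; first exact: cvgP h.
  by apply: nearW => k; rewrite -lee_fin fineK ?fP.
move=> w /= hw; have [al nsurv] : (forall n, pop (sample (coin keep w) n 0 0) != 0%N) /\
    ~ 0 < limit_surv lam (coin keep w) 0 0.
  by split; [apply: contrapT => h; apply: hw => /h | move=> h; apply: hw].
move=> k _; split; last by move=> [n _ /= h]; have := al n; rewrite h.
have : limit_surv lam (coin keep w) 0 0 < lam ^+ k.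
  by rewrite (le_lt_trans _ (exprn_gt0 k l0)) // leNgt; apply/negP.
have cv := cvg_limit_surv (c := coin keep w) lam01 (m := 0) (q := 0).
move=> h; have := cvgr_lt _ cv _ h; case=> N _ /(_ N (leqnn N)) /= hN.
by exists N.
Qed.

End survival.

(** * Growth of the number of descendants *)

Lemma bernoulli_ineq (R : realType) (x : R) n : 0 <= x -> 1 + x *+ n <= (1 + x) ^+ n.
Proof.
move=> x0; elim: n => [|n IH]; first by rewrite mulr0n addr0 expr0.
rewrite exprS mulrS; have xn : 0 <= x *+ n by rewrite mulrn_wge0.
have : (1 + x) * (1 + x *+ n) <= (1 + x) * (1 + x) ^+ n by rewrite ler_wpM2l ?addr_ge0.
have : 0 <= x * (x *+ n) by rewrite mulr_ge0.
rewrite mulrDl mul1r mulrDr mulr1; lra.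
Qed.

Lemma expr_unbounded (R : realType) (a M : R) : 1 < a -> exists j, M <= a ^+ j.
Proof.
move=> a1; have ha : 0 < a - 1 by rewrite subr_gt0.
exists (Num.truncn (M / (a - 1))).+1.
have h := truncnS_gt (M / (a - 1)).
have := bernoulli_ineq (Num.truncn (M / (a - 1))).+1 (ltW ha).
rewrite (_ : 1 + (a - 1) = a); last by ring.
apply: le_trans.
by move: h; rewrite ltr_pdivrMr // -mulr_natl; lra.
Qed.

Section tail.
Context {R : realType} {d : measure_display} {Omega : measurableType d}.
Variables (P : probability Omega R) (p b : R) (keep : set R -> set Omega).
Hypothesis coinsP : percolation_coins P p keep.
Hypothesis p01 : 0 <= p <= 1.
Hypothesis p_super : 1 <= 2 * p < b.

(** Exponential Markov inequality with the factor 1 + x, where x = del / b'^K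
    is the largest one that pop_gen_le controls up to generation K for some
    2 p < b' < b.  On the event the population is at least j N with N >= b^K, so
    (1 + x)^pop is at least (x b^K)^j = del^j ((b / b')^j)^K, where j is chosen
    with (b / b')^j >= M. *)
Lemma pop_tail (M : R) : 0 < M -> exists C D : R, [/\ 0 <= C, 0 <= D &
  forall K, tree_prob p (fun t : coin_tree K => D * b ^+ K <= (pop t)%:R) <= C / M ^+ K].
Proof.
move=> M0; have /andP[p0 p1] := p01; have /andP[mu1 mub] := p_super.
(* p^2 <= 1, so that 2 p + p^2 del <= b'. *)
pose b' := (2 * p + b) / 2; pose del := b' - 2 * p.
have b'1 : 1 <= b' by rewrite /b'; lra.
have b'b : b' < b by rewrite /b'; lra.
have b'0 : 0 < b' by lra.
have b1 : 1 <= b by lra.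
have del0 : 0 < del by rewrite /del /b'; lra.
have hdel : 2 * p + p ^+ 2 * del <= b'.
  have : p ^+ 2 * del <= 1 * del by rewrite ler_wpM2r ?(ltW del0) // expr_le1.
  by rewrite /del; lra.
have [j hj] : exists j, M <= (b / b') ^+ j by apply: expr_unbounded; rewrite ltr_pdivlMr // mul1r.
exists ((1 + del) / del ^+ j), (2 * j%:R); split.
- by rewrite divr_ge0 ?exprn_ge0 //; lra.
- by rewrite mulr_ge0.
move=> K; pose x := del / b' ^+ K.
have x0 : 0 < x by rewrite divr_gt0 ?exprn_gt0.
have xb : x * b' ^+ K = del by rewrite /x divfK // expf_neq0 // gt_eqF.
have xb' : x * b' ^+ K <= del by rewrite xb.
have mean := pop_gen_le p01 (ltW del0) b'1 hdel (ltW x0) xb'.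
rewrite xb in mean.
have a0 : 0 < del ^+ j * M ^+ K by rewrite mulr_gt0 ?exprn_gt0.
have -> : (1 + del) / del ^+ j / M ^+ K = (1 + del) / (del ^+ j * M ^+ K).
  by rewrite invfM mulrA.
apply: le_trans (ler_wpM2r _ mean); last by rewrite invr_ge0 ltW.
apply: tree_prob_markov => // [t|t ht]; first by rewrite exprn_ge0 // addr_ge0 // ltW.
pose N := (Num.truncn (b ^+ K)).+1.
have bK1 : 1 <= b ^+ K by rewrite exprn_ege1.
have NK : b ^+ K <= N%:R by apply/ltW/truncnS_gt.
have NK2 : N%:R <= 2 * b ^+ K.
  have := truncn_le (b ^+ K); rewrite (le_trans ler01 bK1) /N -natr1 => h; lra.
have hN : (j * N <= pop t)%N.
  rewrite -(ler_nat R) natrM; apply: le_trans ht.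
  have : j%:R * N%:R <= j%:R * (2 * b ^+ K) by rewrite ler_wpM2l.
  by lra.
apply: (@le_trans _ _ ((1 + x) ^+ (j * N))); last by rewrite ler_weXn2l // lerDl ltW.
rewrite mulnC exprM.
apply: (@le_trans _ _ ((x * b ^+ K) ^+ j)); last first.
  apply: lerXn2r; rewrite ?nnegrE.
  - by rewrite mulr_ge0 ?(ltW x0) // (le_trans ler01).
  - by rewrite exprn_ge0 // addr_ge0 // ltW.
  apply: le_trans (bernoulli_ineq N (ltW x0)).
  rewrite -mulr_natr; have : x * b ^+ K <= x * N%:R by rewrite ler_wpM2l // ltW.
  lra.
have -> : (x * b ^+ K) ^+ j = del ^+ j * ((b / b') ^+ j) ^+ K.
  have -> : ((b / b') ^+ j) ^+ K = ((b / b') ^+ K) ^+ j by rewrite -!exprM mulnC.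
  by rewrite -exprMn expr_div_n /x mulrA mulrAC.
rewrite ler_wpM2l ?exprn_ge0 ?(ltW del0) //; apply: lerXn2r; rewrite ?nnegrE ?(ltW M0) //.
exact: le_trans (ltW M0) hj.
Qed.

Lemma prob_bigsetU_le (I : Type) (s : seq I) (A : I -> set Omega) :
  (forall i, measurable (A i)) ->
  (P (\big[setU/set0]_(i <- s) A i) <= \sum_(i <- s) P (A i))%E.
Proof.
move=> mA; elim: s => [|i s IH]; first by rewrite !big_nil measure0.
rewrite !big_cons; apply: le_trans (leeD2l _ IH).
by apply: measureU2 => //; exact: bigsetU_measurable.
Qed.

(** Borel-Cantelli along K: there are at most 2^(2 L K) pairs (m, q) with
    m <= L K and q < 2^(L K), so the rate M = 2^(2 L + 1) in pop_tail leaves a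
    summable bound; the finitely many remaining K are absorbed in C. *)
Lemma pop_growth_ae (L : nat) : {ae P, forall w, exists C : R, forall K m q,
  (m <= L * K)%N -> (q < 2 ^ m)%N -> (pop (sample (coin keep w) K m q))%:R <= C * b ^+ K}.
Proof.
have /andP[p0 p1] := p01; have /andP[mu1 mub] := p_super.
have b1 : 1 <= b by lra.
have M0 : 0 < 2 ^+ (2 * L).+1 :> R by rewrite exprn_gt0.
have [C [D [C0 D0 tail]]] := pop_tail M0.
pose E K (v : nat * nat) := [set w | (v.2 < 2 ^ v.1)%N &&
  (D * b ^+ K <= (pop (sample (coin keep w) K v.1 v.2))%:R)].
have mE K v : measurable (E K v).
  have [h|h] := boolP (v.2 < 2 ^ v.1)%N.
    rewrite /E h /=.
    by have [] := sample_event coinsP (fun t : coin_tree K => D * b ^+ K <= (pop t)%:R) h.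
  by rewrite /E (negbTE h) /= (_ : [set _ | _] = set0); [exact: measurable0 | apply/seteqP; split].
have PE K v : (P (E K v) <= (C / (2 ^+ (2 * L).+1) ^+ K)%:E)%E.
  have [h|h] := boolP (v.2 < 2 ^ v.1)%N.
    rewrite /E h /=.
    have [_ ->] := sample_event coinsP (fun t : coin_tree K => D * b ^+ K <= (pop t)%:R) h.
    by rewrite lee_fin tail.
  rewrite /E (negbTE h) /= (_ : [set _ | _] = set0); last by apply/seteqP; split.
  by rewrite measure0 lee_fin divr_ge0 // exprn_ge0 // ltW.
pose V K := [seq (m, q) | m <- iota 0 (L * K).+1, q <- iota 0 (2 ^ (L * K))].
pose G K := \big[setU/set0]_(v <- V K) E K v.
have mG K : measurable (G K) by apply: bigsetU_measurable => v _.
have sV K : (size (V K) <= 2 ^ (2 * L * K))%N.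
  rewrite size_allpairs !size_iota -mulnA mul2n -addnn expnD leq_mul2r.
  by rewrite ltn_expl ?orbT.
have PG K : (P (G K) <= (2 * C / (2 ^ K.+1)%:R)%:E)%E.
  apply: (le_trans (prob_bigsetU_le _ _)) => //.
  apply: (@le_trans _ _ (\sum_(v <- V K) (C / (2 ^+ (2 * L).+1) ^+ K)%:E)%E).
    by apply: lee_sum => v _.
  rewrite sumEFin lee_fin big_const_seq count_predT iter_addr_0.
  rewrite -(mulr_natl _ (size _)).
  apply: (@le_trans _ _ ((2 ^ (2 * L * K))%:R * (C / (2 ^+ (2 * L).+1) ^+ K))).
    by rewrite ler_wpM2r ?ler_nat // divr_ge0 // exprn_ge0 // ltW.
  rewrite -exprM mulSn exprD !natrX exprS.
  set y := 2 ^+ (2 * L * K); have y0 : y != 0 by rewrite expf_neq0.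
  set z := 2 ^+ K; have z0 : z != 0 by rewrite expf_neq0.
  by rewrite le_eqVlt; apply/orP; left; apply/eqP; field; apply/andP.
exists (lim_sup_set G); split.
- by apply: bigcapT_measurable => n; apply: bigcup_measurable.
- apply: lim_sup_set_cvg0 => //.
  apply: (@le_lt_trans _ _ (2 * C)%:E); last exact: ltry.
  apply: le_trans (epsilon_trick0 xpredT _); last by rewrite mulr_ge0.
  by apply: lee_nneseries => [i _ _|i _]; [exact: measure_ge0|exact: PG].
move=> w /= nw; apply: contrapT => nl; apply: nw.
have [N hN] : exists N, forall K, (N <= K)%N -> ~ G K w.
  apply: contrapT => h; apply: nl => n _; apply: contrapT => h2.
  by apply: h; exists n => K nK GK; apply: h2; exists K.
exists (D + 2 ^+ N) => K m q mK qm.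
have bK : 1 <= b ^+ K by rewrite exprn_ege1.
have [NK|/ltnW KN] := leqP N K.
  have : ~ E K (m, q) w.
    move=> h; apply: (hN K NK); rewrite /G -bigcup_seq; exists (m, q) => //=.
    apply/allpairsP; exists (m, q); split=> //; rewrite mem_iota //=.
    by rewrite add0n (leq_trans qm) // leq_pexp2l.
  rewrite /E /= qm /= => /negP; rewrite -ltNge => /ltW /le_trans; apply.
  by rewrite mulrDl lerDl mulr_ge0 ?exprn_ge0 // (le_trans ler01).
apply: (@le_trans _ _ (2 ^+ N * 1)).
  by rewrite mulr1 -natrX ler_nat (leq_trans (pop_bound _)) // leq_pexp2l.
rewrite mulrDl; have : 2 ^+ N * 1 <= 2 ^+ N * b ^+ K by rewrite ler_wpM2l ?exprn_ge0.
have : 0 <= D * b ^+ K by rewrite mulr_ge0 // (le_trans ler01).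
lra.
Qed.

End tail.

(** * Coverings of the limit set *)

Lemma size_flatten_le (R : realType) (f : nat -> seq nat) (B : R) (s : seq nat) :
  (forall q, (size (f q))%:R <= B) -> (size (flatten [seq f q | q <- s]))%:R <= (size s)%:R * B.
Proof.
move=> h; elim: s => [|q s IH] /=; first by rewrite mul0r.
by rewrite size_cat natrD -natr1 mulrDl mul1r addrC lerD.
Qed.

Lemma half_pow_small (R : realType) (x : R) : 0 < x -> exists n, 2 ^- n < x.
Proof.
move=> x0; have [n hn] := @expr_unbounded R 2 (x^-1 + 1) (ltr1n R 2).
exists n; rewrite invf_plt ?posrE ?exprn_gt0 //; lra.
Qed.

Section covering.
Context {R : realType}.
Variables (c : nat -> nat -> bool) (G : set R^o) (beta eps C : R) (L : nat).
Hypothesis HG : forall x, G x -> forall m, exists2 q, alive c m q & dyad m q x.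
Hypothesis eps01 : 0 < eps < 1.
Hypothesis beta0 : 0 <= beta.
Hypothesis Leps : 1 <= L%:R * eps.
Hypothesis growth : forall K m q, (m <= L * K)%N -> (q < 2 ^ m)%N ->
  (pop (sample c K m q))%:R <= C * (2 `^ beta) ^+ K.

(** The points of the ball lie below at most 5 vertices of order m, so the
    intervals of order n that meet the ball within the set are among the
    descendants of these; each contributes one ball, centred in the set. *)
Lemma covering_size (r rho : R) (x : R) (n m : nat) : G x ->
  2 ^- n <= r / 2 -> (m <= n)%N -> (m <= L * (n - m))%N -> (m = 0%N \/ rho <= 2 ^- m) ->
  (covering_number G r (cball G (x : R^o) rho) <= (5 * (C * (2 `^ beta) ^+ (n - m)))%:E)%E.
Proof.
move=> Gx nr mn mL mrho; set K := (n - m)%N.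
have nE : n = (m + K)%N by rewrite subnKC.
have C0 : 0 <= C.
  have := growth (leq0n (L * 0)) (isT : (0 < 2 ^ 0)%N).
  by rewrite /= expr0 mulr1; apply: le_trans; rewrite ler0n.
have [q0 aq0 q0x] := HG Gx m.
pose f q := if (q < 2 ^ m)%N then desc c K m q else [::].
pose js := flatten [seq f q | q <- iota (q0 - 2) 5].
have ctr_ex j : exists y : R, G y /\ ((exists2 z : R, G z & dyad n j z) -> dyad n j y).
  have [[z Gz jz]|h] := pselect (exists2 z : R, G z & dyad n j z); first by exists z.
  by exists x; split.
have [ctr hctr] := choice ctr_ex.
apply: (@le_trans _ _ (size [seq (ctr j : R^o) | j <- js])%:R%:E); last first.
  have hf q : (size (f q))%:R <= C * (2 `^ beta) ^+ K.
    rewrite /f; case: ifP => [qm|_]; first by rewrite size_desc growth.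
    by rewrite mulr_ge0 // exprn_ge0 // powR_ge0.
  by have := size_flatten_le (iota (q0 - 2) 5) hf; rewrite lee_fin size_map size_iota.
apply: ereal_inf_lbound; exists [seq (ctr j : R^o) | j <- js] => //; split.
  by move=> _ /mapP[j _ ->]; have [] := hctr j.
move=> y [Gy xy].
have [j aj jy] := HG Gy n.
have jcy : dyad n j (ctr j) by have [_] := hctr j; apply; exists y.
exists (ctr j); last first.
  by split => //; exact: le_trans (dyad_dist jy jcy) nr.
rewrite /=; apply/mapP; exists j => //; apply/flatten_mapP.
rewrite nE in aj jy; have aq := alive_div aj; have qy := dyad_sub_div jy.
exists (j %/ 2 ^ K)%N; last by rewrite /f (alive_lt aq); exact: mem_desc.
rewrite mem_iota; move: (alive_lt aq) qy; move: (j %/ 2 ^ K)%N => q {aq} qm qy.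
case: mrho => [m0|rm].
  by move: qm (alive_lt aq0); rewrite m0 expn0; clear; lia.
have [] := dyad_near q0x qy _; last by clear; lia.
by rewrite distrC; exact: le_trans xy rm.
Qed.

(** The order n is the least one with 2^-n <= r / 2, and m the largest one with
    rho <= 2^-m, or 0 if rho is larger than 1.  Then r^(1 - eps) <= rho gives
    m <= (1 - eps) n, that is, m <= L (n - m). *)
Lemma dimA_eps_le : (dimA_eps eps G <= beta%:E)%E.
Proof.
have /andP[e0 e1] := eps01.
have C0 : 0 <= C.
  have := growth (leq0n (L * 0)) (isT : (0 < 2 ^ 0)%N).
  by rewrite /= expr0 mulr1; apply: le_trans; rewrite ler0n.
apply: ereal_inf_lbound; exists beta => //=; exists (5 * C * 8 `^ beta).
move=> r rho r0 r1 r2; apply: ge_ereal_sup => _ [x Gx <-].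
have {}r1 : r <= 1.
  rewrite leNgt; apply/negP => h; move: r1; rewrite leNgt => /negP; apply.
  by rewrite -[ltRHS]powRr1 ?(ltW r0) // ltr_powR_gt1 // ltrBlDr ltrDl.
have rho0 : 0 < rho by rewrite (lt_le_trans _ r2) // powR_gt0.
have [n [n1 n2]] : exists n, 2 ^- n <= r / 2 /\ 2 ^+ n <= 4 / r.
  have ex : exists n, 2 ^- n <= r / 2.
    by have [n h] := half_pow_small (divr_gt0 r0 (ltr0n R 2)); exists n; exact: ltW.
  case: (ex_minnP ex) => n h nmin; exists n; split=> //.
  case: n h nmin => [|n] h nmin; first by move: h; rewrite expr0 invr1; lra.
  have : r / 2 < 2 ^- n by rewrite ltNge; apply/negP => /nmin; rewrite ltnn.
  rewrite -[2 ^- n]mul1r ltr_pdivlMr ?exprn_gt0 // => h2; rewrite ler_pdivlMr // exprS; lra.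
have [m [m1 m2]] : exists m, 2 ^- m <= 2 * rho /\ (m = 0%N \/ rho <= 2 ^- m).
  have ex := half_pow_small rho0.
  case: (ex_minnP ex) => -[|m] h mmin.
    by exists 0%N; split; [move: h; rewrite expr0 invr1; lra | left].
  exists m; split; last by right; rewrite leNgt; apply/negP => /mmin; rewrite ltnn.
  by move: h; rewrite exprS invfM; lra.
have [mn mL] : (m <= n)%N /\ (m <= L * (n - m))%N.
  case: m2 => [->|m2]; first by rewrite !leq0n.
  have mreal : m%:R <= n%:R * (1 - eps).
    rewrite leNgt; apply/negP => h.
    have : 2 `^ (- m%:R) < 2 `^ (- (n%:R * (1 - eps))) :> R.
      by apply: ltr_powR_gt1; rewrite ?ltr1n // ltrN2.
    rewrite -mulNr powRrM !powR_invn // ltNge => /negP; apply.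
    apply: le_trans m2; apply: le_trans r2.
    apply: ge0_ler_powR; rewrite ?nnegrE ?invr_ge0 ?exprn_ge0 ?(ltW r0) //; lra.
  have n0 : 0 <= n%:R :> R by [].
  have mn : (m <= n)%N by rewrite -(ler_nat R); nra.
  split=> //; rewrite -(ler_nat R) natrM natrB //.
  have L0 : 0 <= L%:R :> R by [].
  have h1 : L%:R * (n%:R * eps) <= L%:R * (n%:R - m%:R) :> R by rewrite ler_wpM2l //; lra.
  have h2 : n%:R <= L%:R * eps * n%:R by rewrite -[X in X <= _]mul1r ler_wpM2r.
  have h3 : m%:R <= n%:R :> R by rewrite ler_nat.
  lra.
apply: le_trans (covering_size Gx n1 mn mL m2) _; rewrite lee_fin.
rewrite -!mulrA ler_wpM2l // ler_wpM2l // -powRM ?divr_ge0 ?(ltW rho0) ?(ltW r0) //.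
have -> : (2 `^ beta) ^+ (n - m) = (2 ^+ (n - m)) `^ beta :> R.
  rewrite -(powR_mulrn _ (powR_ge0 2 beta)) -(powR_mulrn (n - m) (ler0n R 2)).
  by rewrite -!powRrM mulrC.
apply: ge0_ler_powR; rewrite ?nnegrE ?exprn_ge0 ?mulr_ge0 ?invr_ge0 ?(ltW rho0) ?(ltW r0) //.
have -> : 2 ^+ (n - m) = 2 ^+ n * 2 ^- m :> R.
  by rewrite -{2}(subnK mn) exprD mulfK // expf_neq0.
have : 2 ^+ n * 2 ^- m <= 4 / r * (2 * rho).
  by apply: ler_pM; rewrite ?exprn_ge0 ?invr_ge0 ?exprn_ge0.
by move/le_trans; apply; lra.
Qed.

End covering.

(** * The dimension of the limit set *)

Theorem theorem6p5 (R : realType) (d : measure_display)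
    (Omega : measurableType d) (P : probability Omega R) (gamma : R)
    (keep : set R -> set Omega) :
  0 < gamma < 1 ->
  percolation_coins P (2 `^ (- gamma)) keep ->
  {ae P, forall w : Omega,
    percolation_limit keep w !=set0 ->
    dimMA (percolation_limit keep w) = dimH (percolation_limit keep w) /\
    dimH (percolation_limit keep w) = (1 - gamma)%:E}.
Proof.
move=> /andP[g0 g1] coinsP.
pose p : R := 2 `^ (- gamma).
have p0 : 0 < p by rewrite powR_gt0.
have p1 : p <= 1 by rewrite -(powRr0 2) ler_powR ?ler1n // oppr_le0 ltW.
have mu : 2 * p = 2 `^ (1 - gamma).
  by rewrite powRD ?pnatr_eq0 ?implybT // powRr1.
(* Almost sure statements are intersected over countably many exponents only:
   sig j and tau j tend to 1 - gamma from below and from above. *)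
pose tau j : R := 1 - gamma + (1 - gamma) / j.+1%:R.
pose sig j : R := (1 - gamma) - (1 - gamma) / j.+2%:R.
have d0 j : 0 < (1 - gamma) / j.+1%:R by rewrite divr_gt0 // subr_gt0.
have sj0 j : 0 < sig j.
  rewrite /sig -[X in X - _]mulr1 -mulrBr mulr_gt0 ?subr_gt0 //.
  by rewrite invf_lt1 // ltr1n.
have lower : {ae P, forall w, forall j,
    (forall n, pop (sample (coin keep w) n 0 0) != 0%N) ->
    0 < limit_surv (2 `^ (- sig j)) (coin keep w) 0 0}.
  apply: ae_foralln => j.
  apply: (limit_surv_gt0_ae coinsP); first by rewrite p0 p1.
    by rewrite powR_gt0 //= -[ltRHS](powRr0 2) ltr_powR_gt1 ?ltr1n // oppr_lt0.
  rewrite mu -powRD ?pnatr_eq0 ?implybT // -[ltLHS](powRr0 2) ltr_powR_gt1 ?ltr1n //.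
  by rewrite /sig opprB addrC subrK; exact: d0 j.+1.
have upper : {ae P, forall w, forall L j, exists C : R, forall K m q,
    (m <= L * K)%N -> (q < 2 ^ m)%N ->
    (pop (sample (coin keep w) K m q))%:R <= C * (2 `^ tau j) ^+ K}.
  apply: ae_foralln => L; apply: ae_foralln => j.
  apply: (pop_growth_ae coinsP); first by rewrite (ltW p0) p1.
  rewrite mu ltr_powR_gt1 ?ltr1n ?ltrDl // andbT -[leLHS](powRr0 2) ler_powR ?ler1n //.
  by rewrite subr_ge0 ltW.
apply: filterS2 lower upper => w lw uw [x0 Gx0].
set G := percolation_limit keep w in Gx0 *.
have GP x : G x <-> forall m, exists2 q, alive (coin keep w) m q & dyad m q x.
  exact: percolation_limitP.
have vanish (e : R) : 0 < e -> exists j, (1 - gamma) / j.+1%:R <= e.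
  move=> e0; exists (Num.truncn ((1 - gamma) / e)).
  rewrite ler_pdivrMr // mulrC -ler_pdivrMr //; exact/ltW/truncnS_gt.
have geH : ((1 - gamma)%:E <= dimH G)%E.
  apply/lee_subgt0Pr => e e0; have [j hj] := vanish _ e0.
  apply: (@le_trans _ _ (sig j)%:E).
    rewrite -EFinB lee_fin /sig lerB // (le_trans _ hj) // ler_wpM2l ?subr_ge0 ?(ltW g1) //.
    by rewrite lef_pV2 ?posrE // ler_nat.
  apply: (@dimH_ge _ _ (coin keep w)) => [||x hx]; last exact/GP.
    by rewrite sj0 /= /sig; have := d0 j.+1; move: (_ / _) => z; lra.
  apply: lw => n; rewrite -size_desc -lt0n.
  have [q aq _] := (GP x0).1 Gx0 n.
  have := @mem_desc (coin keep w) n 0 q aq.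
  rewrite divn_small ?(alive_lt aq) //; by case: desc.
have leMA : (dimMA G <= (1 - gamma)%:E)%E.
  apply: ge_ereal_sup => _ [eps /= eps01 <-].
  apply/lee_addgt0Pr => e e0; have [j hj] := vanish _ e0.
  apply: (@le_trans _ _ (tau j)%:E); last by rewrite -EFinD lee_fin lerD2l.
  apply: (@le_trans _ _ (dimA_eps eps G)).
    apply: ereal_inf_lbound; exists (fun=> G).
      by apply/seteqP; split => [x Gx|x [i _ //]]; exists 0%N.
    apply/le_anti/andP; split; last by apply: ereal_sup_ubound; exists 0%N.
    by apply: ge_ereal_sup => _ [i _ <-].
  pose L := (Num.truncn eps^-1).+1.
  have Le : 1 <= L%:R * eps.
    have /andP[ep0 _] := eps01.
    by rewrite -ler_pdivrMr // mul1r; exact/ltW/truncnS_gt.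
  have [C hC] := uw L j.
  apply: (@dimA_eps_le _ (coin keep w) G (tau j) eps C L) => //.
    by move=> x /GP.
  by rewrite /tau addr_ge0 ?subr_ge0 ?(ltW g1) // ltW.
have bound (x y : R^o) : G x -> G y -> mdist x y <= 1.
  move=> /GP /(_ 0%N) [q aq qx] /GP /(_ 0%N) [q' aq' qy].
  have := @dyad_dist R 0 q y x; rewrite expr0 invr1; apply=> //.
  by move: aq aq' qy => /= /eqP -> /eqP ->.
have HMA := dimH_le_dimMA bound.
have MA : ((1 - gamma)%:E <= dimMA G)%E.
  have := le_trans geH HMA; rewrite le_max => /orP[//|].
  by rewrite lee_fin leNgt subr_gt0 g1.
have E : dimMA G = (1 - gamma)%:E by apply/le_anti; rewrite leMA MA.
rewrite E; suff -> : dimH G = (1 - gamma)%:E by [].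
apply/le_anti; rewrite geH andbT (le_trans HMA) // E ge_max lexx lee_fin subr_ge0 ltW //.
Qed.
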